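(* Let $A=(a_{ij})$ be a $d\times n$ integer matrix whose columns span $\mathbb{Z}^d$. Let $w\in\mathbb{Z}^n$ and $\beta\in\mathbb{C}^d$ both be generic, and let $M=\mathrm{in}_\tau(I_{\tilde A})\subset\mathbb{C}[\partial_1,\ldots,\partial_n]$ with set $\mathcal{T}(M)$ of top-dimensional standard pairs. Then the indicial polynomial ($b$-function) of $H_{A,w}(\beta)$ along $t=0$ is $$\prod_{(\partial^b,\sigma)\in\mathcal{T}(M)}\bigl(s-w\cdot\beta^{(\partial^b,\sigma)}\bigr).$$ If $\mathcal{T}(M)$ is the empty set, the indicial polynomial is $0$.
   Context: $\mathbb{N}=\{0,1,2,\ldots\}$. $D=\mathbb{C}\langle x_1,\ldots,x_n,t,\partial_1,\ldots,\partial_n,\partial_t\rangle$ is the Weyl algebra in $n+1$ variables, where $\partial_i=\partial/\partial x_i$ and $\partial_t=\partial/\partial t$. Let $\tilde A$ be the $(d+1)\times(n+1)$ matrix $$\tilde A=\begin{pmatrix} a_{11}&\cdots&a_{1n}&0\\ \vdots& &\vdots&\vdots\\ a_{d1}&\cdots&a_{dn}&0\\ w_1&\cdots&w_n&1\end{pmatrix}.$$ $I_{\tilde A}$ is the toric ideal in the commutative polynomial ring $\mathbb{C}[\partial_1,\ldots,\partial_n,t]\subset D$ generated by all $\prod_{i=1}^n\partial_i^{u_i}\,t^{u_{n+1}}-\prod_{j=1}^n\partial_j^{v_j}\,t^{v_{n+1}}$ with $u,v\in\mathbb{N}^{n+1}$ and $\tilde Au=\tilde Av$. The modified $\mathcal{A}$-hypergeometric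 ideal $H_{A,w}(\beta)$ is the left ideal of $D$ generated by $\sum_{j=1}^n a_{ij}x_j\partial_j-\beta_i$ ($i=1,\ldots,d$), $\sum_{j=1}^n w_jx_j\partial_j-t\partial_t$, and $I_{\tilde A}$. Initial ideals: $\tau=(\mathbf{0},-1;\mathbf{0},1)$ is the weight vector giving weight $-1$ to $t$, weight $1$ to $\partial_t$, and weight $0$ to all $x_i,\partial_i$. For a nonzero $\ell\in D$, written in normally ordered form as a combination of monomials $x^et^p\partial^c\partial_t^q$, $\mathrm{in}_\tau(\ell)\in D$ is the sum of the terms for which $-p+q$ is maximal; for a left ideal $I$ of $D$, $\mathrm{in}_\tau(I)$ is the left ideal of $D$ consisting of all $\mathbb{C}$-linear combinations of $\mathrm{in}_\tau(\ell)$, $\ell\in I\setminus\{0\}$. For generic $w$, $\mathrm{in}_\tau(D\cdot I_{\tilde A})$ is generated by monomials in $\mathbb{C}[\partial_1,\ldots,\partial_n]$; $M=\mathrm{in}_\tau(I_{\tilde A})$ denotes the monomial ideal of the commutative ring $\mathbb{C}[\partial_1,\ldots,\partial_n]$ generated by these monomials. Indicial polynomial: the indicial polynomial ($b$-function) of $H_{A,w}(\beta)$ along $t=0$ is the monic polynomial $b(s)\in\mathbb{C}[s]$ such that $b(t\partial_t)$ generates the ideal $\mathrm{in}_\tau(H_{A,w}(\beta))\cap\mathbb{C}[t\partial_t]$ of $\mathbb{C}[t\partial_t]$, with the convention that in the degenerate case $1\in\mathrm{in}_\tau(H_{A,w}(\beta))$ the indicial polynomial is declared to be $0$. The displayed product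 is understood for $\mathcal{T}(M)\neq\emptyset$. Standard pairs: a standard pair of $M$ is a pair $(\partial^b,\sigma)$ with $b\in\mathbb{N}^n$, $\sigma\subset\{1,\ldots,n\}$ such that (i) $b_i=0$ for $i\in\sigma$; (ii) for all $c_j\in\mathbb{N}$ ($j\in\sigma$), $\partial^b\prod_{j\in\sigma}\partial_j^{c_j}\notin M$; (iii) for every $l\notin\sigma$ there exist $c_l\in\mathbb{N}$ and $c_j\in\mathbb{N}$ ($j\in\sigma$) with $\partial^b\,\partial_l^{c_l}\prod_{j\in\sigma}\partial_j^{c_j}\in M$. $\mathcal{T}(M)$ is the set of top-dimensional standard pairs, i.e. those with $\#\sigma=d$. For $(\partial^b,\sigma)\in\mathcal{T}(M)$, $\beta^{(\partial^b,\sigma)}\in\mathbb{C}^n$ is the associated zero of the distraction of $M$ together with $A\theta-\beta$ ($\theta_i=x_i\partial_i$), i.e. the unique vector $v\in\mathbb{C}^n$ with $v_i=b_i$ for $i\notin\sigma$ and $Av=\beta$. The dot in $w\cdot v$ denotes $\sum_i w_iv_i$. Genericity: ''generic $w$'' means $w\in\mathbb{Z}^n$ outside a finite union of proper linear hyperplanes depending only on $A$; ''generic $\beta$'' means $\beta\in\mathbb{C}^d$ outside a proper Zariski closed subset of $\mathbb{C}^d$ (which may depend on $A$ and $w$). Thus the claim asserts that such exceptional sets exist with the conclusion holding for all $w,\beta$ outside them. *)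

(* Defs.v *)
From HB Require Import structures.
From mathcomp Require Import all_boot all_order all_algebra.
From mathcomp Require Import classical_sets.
From mathcomp.multinomials Require Import ssrcomplements mpoly.

Set Implicit Arguments.
Unset Strict Implicit.
Unset Printing Implicit Defensive.

Import GRing.Theory.
Local Open Scope ring_scope.
Local Open Scope classical_set_scope.

(* -------------------------------------------------------------------------- *)
(* The Weyl algebra K<x_1..x_N, d_1..d_N>.                                    *)
(*                                                                            *)
(* An operator is stored through its normally ordered form                    *)
(*   sum_(a, b) c_(a,b) x^a d^b,                                              *)
(* written as the polynomial sum_(a, b) c_(a,b) x^a xi^b in 2N commuting      *)
(* variables, with x_i = 'X_(lshift N i) and xi_i = 'X_(rshift N i).          *)

Record weyl (K : comNzRingType) (N : nat) :=
  Weyl { symbol : {mpoly K[N + N]} }.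

Section WeylAlgebra.
Variables (K : comNzRingType) (N : nat).
Local Notation P := {mpoly K[N + N]}.
Local Notation xv i := (lshift N i).
Local Notation dv i := (rshift N i).
Implicit Types (p q r : P) (m : 'X_{1..N + N}) (i j : 'I_N) (b : 'I_N -> nat).

(* Left multiplication by d_i, from the Leibniz rule                          *)
(*   d_i x^a d^b = x^a d_i d^b + (d x^a / d x_i) d^b.                         *)
Definition dop i p : P := 'X_(dv i) * p + p^`M(xv i).

Definition dopm b p : P :=
  foldr (fun i => iter (b i) (dop i)) p (enum 'I_N).

Definition xpart m : 'X_{1..N + N} :=
  [multinom (if (k < N)%N then m k else 0%N) | k < N + N].

(* Left multiplication by the normally ordered monomial x^a d^b coded by m. *)
Definition mop m p : P := 'X_[xpart m] * dopm (fun i => m (dv i)) p.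

Definition symbol_mul p q : P := \sum_(m <- msupp p) p@_m *: mop m q.

Let dop_is_linear i : linear (dop i).
Proof. by move=> c p q; rewrite /dop mulrDr linearP -scalerAr scalerDr addrACA. Qed.

Let dopm_is_linear b : linear (dopm b).
Proof.
move=> c p q; rewrite /dopm; elim: (enum _) => //= i s ->.
by elim: (b i) => //= k ->; rewrite dop_is_linear.
Qed.

Let mop_is_linear m : linear (mop m).
Proof. by move=> c p q; rewrite /mop dopm_is_linear mulrDr -scalerAr. Qed.

Lemma symbol_mulE k p q : (msize p <= k)%N ->
  symbol_mul p q = \sum_(m : 'X_{1..(N + N) < k}) p@_m *: mop m q.
Proof.
pose I : subFinType _ := 'X_{1..(N + N) < k}.
move=> le_pk; rewrite /symbol_mul (big_mksub I) ?msupp_uniq //=; last first.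
  by move=> x /msize_mdeg_lt/leq_trans/(_ le_pk).
by rewrite big_rmcond //= => j /memN_msupp_eq0 ->; rewrite scale0r.
Qed.

Lemma symbol_mul_linl q : linear (symbol_mul^~ q).
Proof.
move=> c p1 p2 /=.
pose k := maxn (msize (c *: p1 + p2)) (maxn (msize p1) (msize p2)).
rewrite !(@symbol_mulE k) ?leq_max ?leqnn ?orbT // scaler_sumr -big_split /=.
by apply: eq_bigr => m _; rewrite mcoeffD mcoeffZ scalerDl scalerA.
Qed.

Lemma symbol_mul_linr p : linear (symbol_mul p).
Proof.
move=> c q1 q2; rewrite /symbol_mul scaler_sumr -big_split /=.
by apply: eq_bigr => m _; rewrite mop_is_linear scalerDr !scalerA mulrC.
Qed.

Lemma symbol_mulX m q : symbol_mul 'X_[m] q = mop m q.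
Proof. by rewrite /symbol_mul msuppX big_seq1 mcoeffX eqxx scale1r. Qed.

Let ext_lin (f g : P -> P) (lf : linear f) (lg : linear g) :
  (forall m, f 'X_[m] = g 'X_[m]) -> f =1 g.
Proof.
move=> fg; have f0 (h : P -> P) : linear h -> h 0 = 0.
  by move=> lh; have := lh (-1) 0 0; rewrite scaler0 addr0 scaleN1r addNr.
elim/mpolyind => [|c m p _ _ ih]; first by rewrite !f0.
by rewrite lf lg ih fg.
Qed.

Let comp_lin (f g : P -> P) (lf : linear f) (lg : linear g) :
  linear (fun p => f (g p)).
Proof. by move=> c p q; rewrite lg lf. Qed.

Let xmul_lin q : linear (fun p => q * p).
Proof. by move=> c p1 p2; rewrite mulrDr -scalerAr. Qed.

Lemma dopC i j p : dop i (dop j p) = dop j (dop i p).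
Proof.
have nu k l : ('X_(dv k) : P)^`M(xv l) = 0.
  by rewrite mderivX mnm1E eq_rlshift scale0r.
rewrite /dop !mderivD !mderivM !nu !mul0r !add0r !mulrDr.
rewrite (mderiv_comm _ _ p) !mulrA (mulrC 'X_(dv i) 'X_(dv j)) -!addrA.
by congr (_ + _); rewrite addrCA.
Qed.

Lemma dopm_add1 i b p :
  dopm (fun j => (i == j) + b j)%N p = dop i (dopm b p).
Proof.
rewrite /dopm.
have itC j k q : dop i (iter k (dop j) q) = iter k (dop j) (dop i q).
  by elim: k => //= k <-; rewrite dopC.
have: i \in enum 'I_N by rewrite mem_enum.
have: uniq (enum 'I_N) by rewrite enum_uniq.
elim: (enum _) => //= j s ih /andP[js us]; rewrite in_cons.
case: (i =P j) => [->|ne] /= => [_|is_].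
  congr (dop j (iter (b j) (dop j) _)).
  elim: s js {ih us} => //= l s ih; rewrite in_cons negb_or => /andP[jl js].
  by rewrite ih // (negbTE jl).
by rewrite ih // itC.
Qed.

Lemma dopm0 p b : b =1 (fun=> 0%N) -> dopm b p = p.
Proof.
by move=> b0; rewrite /dopm; elim: (enum _) => //= i s ->; rewrite b0.
Qed.

Lemma eq_dopm b1 b2 p : b1 =1 b2 -> dopm b1 p = dopm b2 p.
Proof.
by move=> e; rewrite /dopm; elim: (enum _) => //= i s ->; rewrite e.
Qed.

Lemma symbol_mul_xpart m q r :
  symbol_mul ('X_[xpart m] * q) r = 'X_[xpart m] * symbol_mul q r.
Proof.
move: q; apply: ext_lin => [||m'].
- exact (comp_lin (symbol_mul_linl r) (xmul_lin _)).
- exact (comp_lin (xmul_lin _) (symbol_mul_linl r)).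
rewrite -mpolyXD !symbol_mulX /mop mulrA -mpolyXD; congr ('X_[_] * _).
  by apply/mnmP => k; rewrite mnmE !mnmDE !mnmE; case: (ltnP k N).
by apply: eq_dopm => i; rewrite mnmDE mnmE /= ltnNge leq_addr.
Qed.

Lemma symbol_mul_dop i q r :
  symbol_mul (dop i q) r = dop i (symbol_mul q r).
Proof.
move: q; apply: ext_lin => [||m].
- exact (comp_lin (symbol_mul_linl r) (dop_is_linear i)).
- exact (comp_lin (dop_is_linear i) (symbol_mul_linl r)).
have xpartE k j : xpart m (dv j) = 0%N /\ xpart m (xv k) = m (xv k).
  by rewrite !mnmE /= ltn_ord ltnNge leq_addr.
rewrite {1}/dop -mpolyXD mderivX addrC symbol_mul_linl !symbol_mulX /mop.
rewrite [RHS]/dop mderivM mderivX (xpartE i i).2 (mulrCA 'X_(dv i)) addrCA -mulrDr.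
rewrite -[_ * _ + _^`M(_)]/(dop i _).
rewrite -dopm_add1 -scalerAl; congr (_ *: ('X_[_] * _) + 'X_[_] * _).
- apply/mnmP => k; rewrite !(mnmE, mnmBE, mnm1E).
  by case: (ltnP k N) => // kN; case: eqP => // e; rewrite -e /= leqNgt ltn_ord in kN.
- by apply: eq_dopm => j; rewrite mnmBE mnm1E eq_lrshift subn0.
- apply/mnmP => k; rewrite !(mnmE, mnmDE, mnm1E).
  by case: (ltnP k N) => // kN; case: eqP => // e; rewrite -e /= ltnNge leq_addr in kN.
- by apply: eq_dopm => j; rewrite mnmDE mnm1E eq_rshift.
Qed.

Lemma symbol_mulA : associative symbol_mul.
Proof.
move=> p q r; symmetry; move: p; apply: ext_lin => [||m].
- by exact (comp_lin (symbol_mul_linl r) (symbol_mul_linl q)).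
- exact: symbol_mul_linl.
rewrite !symbol_mulX /mop symbol_mul_xpart; congr (_ * _).
rewrite /dopm; elim: (enum _) => //= i s <-.
by elim: (m (dv i)) => //= k <-; rewrite symbol_mul_dop.
Qed.

Lemma symbol_mul1 : left_id 1 symbol_mul.
Proof.
move=> p; rewrite -mpolyX0 symbol_mulX /mop dopm0 => [|i]; last exact: mnm0E.
rewrite (_ : xpart 0 = 0%MM) ?mpolyX0 ?mul1r //.
by apply/mnmP => k; rewrite !mnmE if_same.
Qed.

Lemma dopm_symbol b p : (forall i, p^`M(xv i) = 0) ->
  dopm b p = (\prod_i 'X_(dv i) ^+ b i) * p.
Proof.
move=> dp; rewrite /dopm -big_enum /=.
have nu k l : ('X_(dv k) : P)^`M(xv l) = 0.
  by rewrite mderivX mnm1E eq_rlshift scale0r.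
pose good q := forall l, q^`M(xv l) = 0.
have itg i k q : good q -> iter k (dop i) q = 'X_(dv i) ^+ k * q
    /\ good ('X_(dv i) ^+ k * q).
  move=> gq; elim: k => [|k [ek gk]] /=; first by rewrite mul1r.
  rewrite ek /dop (gk i) addr0 mulrA -exprS; split=> // l.
  by rewrite exprS -mulrA mderivM nu gk mul0r mulr0 addr0.
suff [] : foldr (fun i => iter (b i) (dop i)) p (enum 'I_N)
    = (\prod_(i <- enum 'I_N) 'X_(dv i) ^+ b i) * p
  /\ good ((\prod_(i <- enum 'I_N) 'X_(dv i) ^+ b i) * p) by [].
elim: (enum _) => [|i s [ih gs]] /=; first by rewrite big_nil mul1r.
by have [e g] := itg i (b i) _ gs; rewrite big_cons -mulrA ih e.
Qed.

Lemma mop1 m : mop m 1 = 'X_[m].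
Proof.
rewrite /mop dopm_symbol ?mulr1; last by move=> i; rewrite -mpolyC1 mderivC.
rewrite [RHS]mpolyXE_id [X in X * _]mpolyXE_id !big_split_ord /=.
rewrite [X in _ * X * _]big1 ?mulr1 => [|i _]; last first.
  by rewrite mnmE /= ltnNge leq_addr.
by congr (_ * _); apply: eq_bigr => i _; rewrite mnmE /= ltn_ord.
Qed.

Lemma symbol_mulr1 : right_id 1 symbol_mul.
Proof.
move=> p; rewrite [RHS]mpolyE /symbol_mul.
by apply: eq_bigr => m _; rewrite mop1.
Qed.

Notation W := (weyl K N).

HB.instance Definition _ := [isNew for @symbol K N].
HB.instance Definition _ := [Choice of W by <:].

Lemma symbolP (u v : W) : symbol u = symbol v -> u = v.
Proof. exact: val_inj. Qed.

Let waddA : associative (fun u v : W => Weyl (symbol u + symbol v)).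
Proof. by move=> u v z; rewrite /= addrA. Qed.
Let waddC : commutative (fun u v : W => Weyl (symbol u + symbol v)).
Proof. by move=> u v; rewrite addrC. Qed.
Let wadd0 : left_id (Weyl 0) (fun u v : W => Weyl (symbol u + symbol v)).
Proof. by move=> u; apply: symbolP; rewrite /= add0r. Qed.
Let waddN : left_inverse (Weyl 0) (fun u : W => Weyl (- symbol u))
  (fun u v => Weyl (symbol u + symbol v)).
Proof. by move=> u; apply: symbolP; rewrite /= addNr. Qed.

HB.instance Definition _ := GRing.isZmodule.Build W waddA waddC wadd0 waddN.

Let wmulA : associative (fun u v : W => Weyl (symbol_mul (symbol u) (symbol v))).
Proof. by move=> u v z; rewrite /= symbol_mulA. Qed.
Let wmul1 : left_id (Weyl 1) (fun u v : W => Weyl (symbol_mul (symbol u) (symbol v))).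
Proof. by move=> u; apply: symbolP; rewrite /= symbol_mul1. Qed.
Let wmulr1 : right_id (Weyl 1) (fun u v : W => Weyl (symbol_mul (symbol u) (symbol v))).
Proof. by move=> u; apply: symbolP; rewrite /= symbol_mulr1. Qed.
Let wmulDl : left_distributive
  (fun u v : W => Weyl (symbol_mul (symbol u) (symbol v))) +%R.
Proof.
move=> u v z; apply: symbolP => /=.
by have := symbol_mul_linl (symbol z) 1 (symbol u) (symbol v); rewrite !scale1r.
Qed.
Let wmulDr : right_distributive
  (fun u v : W => Weyl (symbol_mul (symbol u) (symbol v))) +%R.
Proof.
move=> u v z; apply: symbolP => /=.
by have := symbol_mul_linr (symbol u) 1 (symbol v) (symbol z); rewrite !scale1r.
Qed.
Let wone : (Weyl 1 : W) != 0.
Proof.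
apply/eqP => /(congr1 (@symbol K N)) /= e.
have e' : (1 : P) = 0 := e.
by move: (oner_neq0 P); rewrite e' eqxx.
Qed.

HB.instance Definition _ := GRing.Zmodule_isNzRing.Build W
  wmulA wmul1 wmulr1 wmulDl wmulDr wone.

Let wscaleA (a c : K) (u : W) :
  Weyl (a *: symbol (Weyl (c *: symbol u) : W)) = Weyl ((a * c) *: symbol u) :> W.
Proof. by rewrite /= scalerA. Qed.
Let wscale1 : left_id 1 (fun (a : K) (u : W) => Weyl (a *: symbol u)).
Proof. by move=> u; apply: symbolP; rewrite /= scale1r. Qed.
Let wscaleDr :
  right_distributive (fun (a : K) (u : W) => Weyl (a *: symbol u)) +%R.
Proof. by move=> a u v; apply: symbolP; rewrite /= scalerDr. Qed.
Let wscaleDl (u : W) :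
  {morph (fun a : K => Weyl (a *: symbol u) : W) : a c / a + c}.
Proof. by move=> a c; apply: symbolP; rewrite /= scalerDl. Qed.

HB.instance Definition _ := GRing.Zmodule_isLmodule.Build K W
  wscaleA wscale1 wscaleDr wscaleDl.

Let wscaleAl (a : K) (u v : W) : a *: (u * v) = (a *: u) * v.
Proof.
apply: symbolP => /=.
have := symbol_mul_linl (symbol v) a (symbol u) 0.
have := symbol_mul_linl (symbol v) (-1) 0 0.
by rewrite scaler0 addr0 scaleN1r addNr => ->; rewrite !addr0.
Qed.
Let wscaleAr (a : K) (u v : W) : a *: (u * v) = u * (a *: v).
Proof.
apply: symbolP => /=.
have := symbol_mul_linr (symbol u) a (symbol v) 0.
have := symbol_mul_linr (symbol u) (-1) 0 0.
by rewrite scaler0 addr0 scaleN1r addNr => ->; rewrite !addr0.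
Qed.

Let symbol_is_linear : linear (@symbol K N).
Proof. by []. Qed.
HB.instance Definition _ := GRing.isLinear.Build K W P *:%R (@symbol K N)
  symbol_is_linear.

HB.instance Definition _ := GRing.Lmodule_isLalgebra.Build K W wscaleAl.
HB.instance Definition _ := GRing.Lalgebra_isAlgebra.Build K W wscaleAr.

Definition wX i : W := Weyl 'X_(xv i).
Definition wD i : W := Weyl 'X_(dv i).

Lemma symbolX_mul i (u : W) : symbol (wX i * u) = 'X_(xv i) * symbol u.
Proof.
rewrite /= symbol_mulX /mop dopm0 => [|j]; last by rewrite mnm1E eq_lrshift.
congr ('X_[_] * _); apply/mnmP => k; rewrite mnmE mnm1E.
by case: (ltnP k N) => // kN; case: eqP => // e; rewrite -e /= leqNgt ltn_ord in kN.
Qed.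

Lemma symbolD_mul i (u : W) :
  symbol (wD i * u) = 'X_(dv i) * symbol u + (symbol u)^`M(xv i).
Proof.
rewrite /= symbol_mulX /mop.
rewrite (eq_dopm (b2 := fun j => (i == j) + 0)%N); last first.
  by move=> j; rewrite mnm1E eq_rshift addn0.
rewrite dopm_add1 dopm0 // (_ : xpart _ = 0%MM) ?mpolyX0 ?mul1r //.
apply/mnmP => k; rewrite mnmE mnm1E mnm0E.
by case: (ltnP k N) => // kN; case: eqP => // e; rewrite -e /= ltnNge leq_addr in kN.
Qed.

Lemma wXC i j : wX i * wX j = wX j * wX i.
Proof. by apply: symbolP; rewrite !symbolX_mul mulrC. Qed.

Lemma wDC i j : wD i * wD j = wD j * wD i.
Proof.
apply: symbolP; rewrite !symbolD_mul /= !mderivX !mnm1E !eq_rlshift !scale0r.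
by rewrite mulrC.
Qed.

Lemma wDX i j : wD i * wX j = wX j * wD i + (i == j)%:R.
Proof.
apply: symbolP; rewrite symbolD_mul (_ : forall u v : W, symbol (u + v) = symbol u + symbol v) // symbolX_mul /=.
rewrite mderivX mnm1E eq_lshift eq_sym mulrC; congr (_ + _).
case: eqP => [->|_]; last by rewrite scale0r linear0.
rewrite scale1r (_ : _ - _ = 0)%MM ?mpolyX0 //.
by apply/mnmP=> k; rewrite mnmBE subnn mnm0E.
Qed.

(* Every operator is the normally ordered combination given by its symbol. *)
Lemma weyl_normal_form (u : W) :
  u = \sum_(m <- msupp (symbol u)) (symbol u)@_m *:
        ((\prod_i wX i ^+ m (xv i)) * (\prod_i wD i ^+ m (dv i))).
Proof.
apply: symbolP; rewrite linear_sum {1}[symbol u]mpolyE.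
apply: eq_bigr => m _; rewrite linearZ; congr (_ *: _).
have Xpow i k (v : W) : symbol (wX i ^+ k * v) = 'X_(xv i) ^+ k * symbol v.
  by elim: k => [|k ih]; rewrite ?mul1r // !exprS -!mulrA symbolX_mul ih.
have Dpow i k (v : W) : symbol (wD i ^+ k * v) = iter k (dop i) (symbol v).
  by elim: k => [|k ih]; rewrite ?mul1r // exprS -mulrA symbolD_mul ih.
have Xmul (v : W) : symbol ((\prod_i wX i ^+ m (xv i)) * v) =
    (\prod_i 'X_(xv i) ^+ m (xv i)) * symbol v.
  elim/big_ind2: _ v => [|a b c e iha ihc|i _] v; rewrite ?mul1r //.
  by rewrite -mulrA iha ihc mulrA.
apply: etrans (esym (Xmul _)).
have -> : symbol (\prod_i wD i ^+ m (dv i)) =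
    dopm (fun i => m (dv i)) 1.
  rewrite /dopm enumT [index_enum _]unlock.
  elim: (Finite.enum _) => [|i s ih] /=; first by rewrite big_nil.
  by rewrite big_cons Dpow ih.
rewrite -[LHS]mop1 /mop; congr (_ * _).
rewrite mpolyXE_id big_split_ord /= [X in _ * X]big1 ?mulr1 => [|i _].
  by apply: eq_bigr => i _; rewrite mnmE /= ltn_ord.
by rewrite mnmE /= ltnNge leq_addr.
Qed.
End WeylAlgebra.

(* -------------------------------------------------------------------------- *)
(* Linear spans, generated left ideals, initial ideals.                       *)

Definition lin_span (K : nzRingType) (V : lmodType K) (S : set V) : set V :=
  [set v | exists s : seq (K * V),
     (forall c, c \in s -> S c.2) /\ v = \sum_(c <- s) c.1 *: c.2].

Definition left_ideal_gen (R : nzRingType) (S : set R) : set R :=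
  [set v | exists s : seq (R * R),
     (forall c, c \in s -> S c.2) /\ v = \sum_(c <- s) c.1 * c.2].

Section InitialIdeal.
Variables (K : comNzRingType) (N : nat) (u v : 'I_N -> int).

(* Weight u.a + v.b of the normally ordered monomial x^a d^b. *)
Definition weight (m : 'X_{1..N + N}) : int :=
  \sum_i (u i * (m (lshift N i))%:Z + v i * (m (rshift N i))%:Z).

Definition initial_form (l : weyl K N) : weyl K N :=
  let s := msupp (symbol l) in
  Weyl (\sum_(m <- s | all (fun m' => weight m' <= weight m)%R s)
          (symbol l)@_m *: 'X_[m]).

Definition initial_ideal (I : set (weyl K N)) : set (weyl K N) :=
  lin_span [set f | exists l, [/\ I l, l != 0 & f = initial_form l]].
End InitialIdeal.

(* -------------------------------------------------------------------------- *)
(* The Weyl algebra D in x_1, ..., x_n, t.                                    *)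

Section Modified.
Variables (K : fieldType) (d n : nat).
Local Notation D := (weyl K (n + 1)).
Implicit Types (A : 'M[int]_(d, n)) (w : 'rV[int]_n) (beta : 'cV[K]_d).

Definition opx (i : 'I_n) : D := wX K (lshift 1 i).
Definition opd (i : 'I_n) : D := wD K (lshift 1 i).
Definition opt : D := wX K (rshift n ord0).
Definition opdt : D := wD K (rshift n ord0).

Definition tau_x (i : 'I_(n + 1)) : int := if i == rshift n ord0 then -1 else 0.
Definition tau_d (i : 'I_(n + 1)) : int := if i == rshift n ord0 then 1 else 0.

Definition in_tau (I : set D) : set D := initial_ideal tau_x tau_d I.

Definition tildeA A w : 'M[int]_(d + 1, n + 1) := block_mx A 0 w 1%:M.

(* The toric ideal in C[d_1, ..., d_n, t], with d_i = 'X_(lshift 1 i) and     *)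
(* t = 'X_(rshift n ord0).                                                    *)
Definition toric_ideal A w : set {mpoly K[n + 1]} :=
  left_ideal_gen [set f | exists a b : 'X_{1..n + 1},
    tildeA A w *m (\col_i (a i)%:Z) = tildeA A w *m (\col_i (b i)%:Z) /\
    f = 'X_[a] - 'X_[b]].

(* The inclusion of C[d_1, ..., d_n, t] into D. *)
Definition dt_incl (f : {mpoly K[n + 1]}) : D :=
  mmap (in_alg D)
    (fun k => match split k with inl i => opd i | inr _ => opt end) f.

Definition HAw A w beta : set D :=
  left_ideal_gen
    ([set l | exists i : 'I_d,
        l = \sum_j (A i j)%:~R *: (opx j * opd j) - (beta i 0)%:A]
     `|` [set \sum_j (w 0 j)%:~R *: (opx j * opd j) - opt * opdt]
     `|` dt_incl @` toric_ideal A w).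

(* The ideal of C[d_1, ..., d_n] (with d_i = 'X_i) generated by the monomials *)
(* lying in in_tau (D . I_tildeA). If in_tau (D . I_tildeA) is generated by a *)
(* set S of monomials in the d_i, these are the multiples of members of S, so *)
(* this is the ideal generated by S.                                          *)
Definition monomial_in A w : set {mpoly K[n]} :=
  left_ideal_gen [set f | exists2 a : 'X_{1..n}, f = 'X_[a] &
    in_tau (left_ideal_gen (dt_incl @` toric_ideal A w)) (\prod_i opd i ^+ a i)].

(* b is the indicial polynomial of I along t = 0; it is 0 by convention when  *)
(* 1 lies in in_tau I.                                                        *)
Definition is_indicial (I : set D) (b : {poly K}) : Prop :=
  let J := in_tau I in
  let ev := horner_alg (opt * opdt) in
  (J 1 /\ b = 0) \/
  [/\ ~ J 1, b \is monic &
      forall p : {poly K}, J (ev p) <-> exists q : {poly K}, ev p = ev q * ev b].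

(* Standard pairs (d^b, sigma) are coded by (b, sigma). *)
Definition standard_pair (M : set {mpoly K[n]})
    (p : 'X_{1..n} * {set 'I_n}) : Prop :=
  let: (b, sigma) := p in
  [/\ forall i, i \in sigma -> b i = 0%N,
      forall c : 'X_{1..n}, (forall i, i \notin sigma -> c i = 0%N) ->
        ~ M 'X_[b + c] &
      forall l, l \notin sigma -> exists c : 'X_{1..n},
        (forall i, i \notin l |: sigma -> c i = 0%N) /\ M 'X_[b + c]].

Definition top_standard_pair (M : set {mpoly K[n]})
    (p : 'X_{1..n} * {set 'I_n}) : Prop :=
  standard_pair M p /\ #|p.2| = d.

(* Characterizes v = beta^(d^b, sigma) when it has a unique solution. *)
Definition is_exponent A beta (p : 'X_{1..n} * {set 'I_n}) (v : 'cV[K]_n) :=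
  (forall i, i \notin p.2 -> v i 0 = (p.1 i)%:R) /\
  map_mx intr A *m v = beta.

Definition dotw w (v : 'cV[K]_n) : K := \sum_i (w 0 i)%:~R * v i 0.

Definition zariski_closed (Z : set 'cV[K]_d) : Prop :=
  exists F : set {mpoly K[d]},
    Z = [set beta | forall f, F f -> f.@[fun i => beta i 0] = 0].

Definition generic_param (P : 'cV[K]_d -> Prop) : Prop :=
  exists Z, [/\ zariski_closed Z, Z <> setT & forall beta, ~ Z beta -> P beta].

End Modified.

(* The excluded hyperplanes are h^perp, h in hs; integer normals h suffice,   *)
(* since a real hyperplane meets Z^n inside a rational one.                   *)
Definition generic_weight (n : nat) (P : 'rV[int]_n -> Prop) : Prop :=
  exists2 hs : seq 'rV[int]_n, 0 \notin hs &
    forall w : 'rV[int]_n, (forall h, h \in hs -> \sum_i h 0 i * w 0 i != 0) -> P w.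

(* Main.v *)
Require Import Defs.
From HB Require Import structures.
From mathcomp Require Import all_boot all_order all_algebra.
From mathcomp Require Import boolp classical_sets reals.
From mathcomp.real_closed Require Import complex.
From mathcomp.multinomials Require Import ssrcomplements mpoly.
From mathcomp Require Import zify ring.
Import GRing.Theory.
Local Open Scope ring_scope.

Set Implicit Arguments.
Unset Strict Implicit.
Unset Printing Implicit Defensive.
Import Order.TTheory Num.Theory.

(** The initial monomial ideal consists of the exponents that are not optimal, that
    is, not of least [w]-cost among the natural vectors with the same image under
    [A] ([monomial_inP]). Call a pair [(b, sigma)] a face when [b] vanishes on
    [sigma] and [b + N^sigma] consists of optimal exponents. By Dickson's lemma
    finitely many faces cover the optimal exponents ([face_cover]). For [w] off
    finitely many hyperplanes the columns of a face are independent, and the faces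
    with [#sigma = d] are the top-dimensional standard pairs ([top_face_standard]).

    Every exponent is a root. Let [v] be the exponent of a face. In a suitable
    module of formal series the sum, with all coefficients [1], of the basis
    vectors at [(v + u, w.(v + u))] over the integer relations [u] between the
    columns is killed by the whole hypergeometric ideal ([HAw_kills]). The module
    is normalized so that the [d_j] act without denominators, so that resonant
    exponents behave like all others and logarithms never enter. Restricted to the exponents that are
    nonnegative off [sigma], the series starts in [t]-order [w.v], because the face
    consists of optimal exponents; hence an element of the initial ideal kills the
    leading part ([in_tau_kills]), on which [q(t d_t)] acts by [q(w.v)]
    ([in_tau_HAw_root]). The same argument based at a natural exponent proves the
    description of the monomial ideal.

    The product over the exponents lies in the initial ideal. The initial ideal
    contains [x^a d^a], a product of falling factorials in [theta_j = x_j d_j], for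
    all [a] that are not optimal, so it contains every polynomial in the [theta_j]
    vanishing at the optimal exponents ([ffp_vanishing]). Such a polynomial is a
    product of affine forms, one for each face of the cover and vanishing on that
    face. Modulo [A theta - beta] and [w theta - t d_t] the form of a
    top-dimensional face can be chosen to be [t d_t - w.v], and that of a smaller
    face to be a constant ([face_product]), nonzero for generic [beta]. Without
    top-dimensional faces this puts [1] into the initial ideal.

    Finally the roots [w.v] are distinct for generic [w] and [beta]
    ([top_face_forms_differ]), so that a polynomial vanishing at all of them is a
    multiple of the product. *)


(** * Linear functionals on polynomials *)

Section LinearExtension.
Variables (K : comNzRingType) (V : lmodType K) (k : nat).
Implicit Types (p q : {mpoly K[k]}) (phi : 'X_{1..k} -> V).

Definition mlin phi p : V := \sum_(m <- msupp p) p@_m *: phi m.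

Lemma mlinE phi b p : (msize p <= b)%N ->
  mlin phi p = \sum_(m : 'X_{1..k < b}) p@_m *: phi m.
Proof.
move=> le_pb; rewrite /mlin; set I : subFinType _ := 'X_{1..k < b}.
rewrite (big_mksub I) ?msupp_uniq //=; last first.
  by move=> x /msize_mdeg_lt/leq_trans/(_ le_pb).
by rewrite big_rmcond //= => j /memN_msupp_eq0 ->; rewrite scale0r.
Qed.

Lemma mlinP phi a p q : mlin phi (a *: p + q) = a *: mlin phi p + mlin phi q.
Proof.
pose b := maxn (msize (a *: p + q)) (maxn (msize p) (msize q)).
rewrite !(@mlinE _ b) ?leq_max ?leqnn ?orbT // scaler_sumr -big_split /=.
by apply: eq_bigr => m _; rewrite mcoeffD mcoeffZ scalerDl scalerA.
Qed.

Lemma mlin0 phi : mlin phi 0 = 0.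
Proof. by rewrite /mlin msupp0 big_nil. Qed.

Lemma mlinD phi p q : mlin phi (p + q) = mlin phi p + mlin phi q.
Proof. by have := mlinP phi 1 p q; rewrite !scale1r. Qed.

Lemma mlinZ phi a p : mlin phi (a *: p) = a *: mlin phi p.
Proof. by have := mlinP phi a p 0; rewrite !addr0 mlin0 addr0. Qed.

Lemma mlinX phi m : mlin phi 'X_[m] = phi m.
Proof. by rewrite /mlin msuppX big_seq1 mcoeffX eqxx scale1r. Qed.

End LinearExtension.

(** * Modules of formal series over the Weyl algebra *)

Section SeriesModule.
Variables (K : comNzRingType) (N : nat).
Variables c d : 'I_N -> int -> K.
Hypothesis cd : forall i k, c i (k + 1) * d i k = c i k * d i (k - 1) + 1.
Local Notation xv i := (lshift N i).
Local Notation dv i := (rshift N i).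
Implicit Types (P Q : weyl K N) (u : 'cV[int]_N) (g : 'cV[int]_N -> K)
  (m : 'X_{1..N + N}).

Let mulrE (a : K) (x : K^o) : a *: x = a * x. Proof. by []. Qed.

Definition cpow i a k := \prod_(j < a) c i (k - j%:Z).
Definition dpow i b k := \prod_(j < b) d i (k + j%:Z).

Definition mshift m : 'cV[int]_N := \col_i ((m (dv i))%:Z - (m (xv i))%:Z).

Definition mcoef m u :=
  \prod_i (cpow i (m (xv i)) (u i 0) * dpow i (m (dv i)) (u i 0 - (m (xv i))%:Z)).

(** The module of formal sums of basis vectors indexed by all integer vectors
    [u], a sum being given by its coefficient function [g]. The coefficient at [u]
    of [x_i g] is [c_i(u_i) g(u - e_i)], that of [d_i g] is [d_i(u_i) g(u + e_i)],
    and the hypothesis on [c] and [d] is the relation [d_i x_i = x_i d_i + 1].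
    An operator has finitely many terms, so it acts on sums that are infinite in
    all directions. *)
Definition series_act P g u : K :=
  mlin (fun m => mcoef m u * g (u + mshift m) : K^o) (symbol P).

Local Notation e_ i := (delta_mx i 0 : 'cV[int]_N).

Lemma cpowS i a k : cpow i a.+1 k = c i k * cpow i a (k - 1).
Proof.
rewrite /cpow big_ord_recl subr0; congr (_ * _); apply: eq_bigr => j _.
by congr (c i _); rewrite lift0 -addn1 PoszD opprD addrA addrAC.
Qed.

Lemma dpowS i b k : dpow i b.+1 k = d i k * dpow i b (k + 1).
Proof.
rewrite /dpow big_ord_recl addr0; congr (_ * _); apply: eq_bigr => j _.
by congr (d i _); rewrite lift0 -addn1 PoszD addrA addrAC.
Qed.

(** This is [d x^a = x^a d + a x^(a - 1)], read on coefficients. *)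
Lemma cpow_commute i a k :
  d i k * cpow i a (k + 1) = cpow i a k * d i (k - a%:Z) + a%:R * cpow i a.-1 k.
Proof.
elim: a k => [|a IH] k.
  by rewrite /cpow !big_ord0 subr0 mul1r mulr1 mul0r addr0.
rewrite !cpowS addrK mulrA [d i k * _]mulrC cd mulrDl mul1r.
have := IH (k - 1); rewrite subrK => e.
rewrite -[c i k * _ * _]mulrA e.
rewrite (_ : k - 1 - a%:Z = k - a.+1%:Z); last by lia.
case: a {IH e} => [|a] /=.
  by rewrite /cpow !big_ord0; ring.
rewrite !cpowS !mulrDr mulrA -addrA; congr (_ + _).
rewrite (_ : a.+2%:R = a.+1%:R + 1 :> K); last by rewrite -addn1 natrD.
ring.
Qed.

Lemma mshift0 : mshift 0%MM = 0.
Proof. by apply/colP => i; rewrite !mxE !mnm0E subrr. Qed.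

Lemma mcoefX i m u : mcoef (U_(xv i) + m)%MM u = c i (u i 0) * mcoef m (u - e_ i).
Proof.
rewrite /mcoef (bigD1 i) // [in RHS](bigD1 i) //= mulrA; congr (_ * _).
  rewrite !mnmDE !mnm1E eqxx eq_lrshift add0n add1n cpowS !mxE !eqxx -mulrA.
  by congr (_ * (_ * dpow _ _ _)); rewrite intS /=; ring.
apply: eq_bigr => j ji; rewrite !mnmDE !mnm1E eq_lrshift eq_lshift.
by rewrite (negbTE (_ : i != j)) 1?eq_sym // !mxE (negbTE ji) subr0.
Qed.

Lemma mshiftX i m u : u + mshift (U_(xv i) + m) = u - e_ i + mshift m.
Proof.
apply/colP => j; rewrite !mxE !mnmDE !mnm1E eq_lrshift eq_lshift eqxx andbT eq_sym.
by case: eqP => _; rewrite ?add0n ?add1n ?intS /=; ring.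
Qed.

Lemma series_act_wX i P g u :
  series_act (wX K i * P) g u = c i (u i 0) * series_act P g (u - e_ i).
Proof.
rewrite /series_act symbolX_mul.
elim/mpolyind: (symbol P) => [|a m p _ _ IH]; first by rewrite mulr0 !mlin0 mulr0.
rewrite mulrDr !mlinD mulrDr IH; congr (_ + _).
rewrite -scalerAr -mpolyXD !mlinZ !mlinX !mulrE mcoefX mshiftX; ring.
Qed.

Lemma mcoefD i m u :
  mcoef (U_(dv i) + m)%MM u + (m (xv i))%:R * mcoef (m - U_(xv i))%MM u
  = d i (u i 0) * mcoef m (u + e_ i).
Proof.
rewrite /mcoef (bigD1 i) // [in X in _ + X](bigD1 i) // [in RHS](bigD1 i) //=.
set R := \prod_(j | j != i) _; set R1 := \prod_(j | j != i) _; set R2 := \prod_(j | j != i) _.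
have e1 : R = R2.
  apply: eq_bigr => j ji; rewrite !mnmDE !mnm1E eq_rlshift eq_rshift.
  by rewrite (negbTE (_ : i != j)) 1?eq_sym // !mxE (negbTE ji) addr0.
have e2 : R1 = R2.
  apply: eq_bigr => j ji; rewrite !mnmBE !mnm1E eq_lrshift eq_lshift.
  by rewrite (negbTE (_ : i != j)) 1?eq_sym // !mxE (negbTE ji) addr0 !subn0.
rewrite e1 e2 !mulrA -mulrDl; congr (_ * _).
rewrite !mnmDE !mnmBE !mnm1E eq_rlshift eq_lrshift !eqxx add0n add1n subn0 !mxE !eqxx.
rewrite mulr1n cpow_commute dpowS mulrDl; congr (_ + _).
  by rewrite -!mulrA; congr (_ * (_ * dpow _ _ _)); rewrite /=; ring.
case: (m (xv i)) => [|a]; first by rewrite !mul0r.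
by rewrite subn1 /= -!mulrA; congr (_ * (_ * dpow _ _ _)); rewrite intS /=; ring.
Qed.

Lemma mshiftD i m u : u + mshift (U_(dv i) + m) = u + e_ i + mshift m.
Proof.
apply/colP => j; rewrite !mxE !mnmDE !mnm1E eq_rlshift eq_rshift eqxx andbT eq_sym.
by case: eqP => _; rewrite ?add0n ?add1n ?intS /=; ring.
Qed.

Lemma series_act_wD i P g u :
  series_act (wD K i * P) g u = d i (u i 0) * series_act P g (u + e_ i).
Proof.
rewrite /series_act symbolD_mul.
elim/mpolyind: (symbol P) => [|a m p _ _ IH].
  by rewrite mulr0 mderiv0 add0r !mlin0 mulr0.
rewrite mulrDr mderivD addrACA [LHS]mlinD IH !mlinD mulrDr; congr (_ + _).
rewrite -scalerAr -mpolyXD mderivZ mderivX !mlinZ !mlinX !mulrE.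
rewrite [RHS]mulrCA [X in _ = a * X]mulrA -mcoefD [in RHS]mulrDl mulrDr mshiftD; congr (_ + _).
case E: (m (xv i)) => [|b]; first by rewrite !mul0r mulr0.
rewrite (_ : u + mshift (m - U_(xv i)) = u + e_ i + mshift m) -?mulrA //.
apply/colP => j; rewrite !mxE !mnmBE !mnm1E eq_lrshift eq_lshift eqxx andbT eq_sym.
by case: eqP => [->|_] /=; rewrite ?mulr1n ?E ?subn0; lia.
Qed.

Lemma series_actD P Q g u :
  series_act (P + Q) g u = series_act P g u + series_act Q g u.
Proof. exact: (@mlinD _ K^o). Qed.

Lemma series_actZ a P g u : series_act (a *: P) g u = a * series_act P g u.
Proof. exact: (@mlinZ _ K^o). Qed.

Lemma series_act0 g u : series_act 0 g u = 0.
Proof. exact: (@mlin0 _ K^o). Qed.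

Lemma series_actB P Q g u :
  series_act (P - Q) g u = series_act P g u - series_act Q g u.
Proof. by rewrite -scaleN1r series_actD series_actZ mulN1r. Qed.

Lemma series_act_sum (I : Type) (s : seq I) (B : pred I) (F : I -> weyl K N) g u :
  series_act (\sum_(i <- s | B i) F i) g u = \sum_(i <- s | B i) series_act (F i) g u.
Proof.
elim/big_rec2: _ => [|i y P _ <-]; first exact: series_act0.
by rewrite series_actD.
Qed.

Lemma series_act1 g u : series_act 1 g u = g u.
Proof.
rewrite /series_act [symbol _](_ : _ = 'X_[0%MM]); last by rewrite mpolyX0.
rewrite mlinX mshift0 addr0 /mcoef big1 ?mul1r // => i _.
by rewrite !mnm0E /cpow /dpow !big_ord0 mulr1.
Qed.

Lemma series_act_zero P u : series_act P (fun=> 0) u = 0.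
Proof.
by rewrite /series_act /mlin big1 // => m _; rewrite mulr0 scaler0.
Qed.

Lemma series_act_mul P Q g u : series_act (P * Q) g u = series_act P (series_act Q g) u.
Proof.
rewrite (weyl_normal_form P) mulr_suml !series_act_sum; apply: eq_bigr => m _.
rewrite -scalerAl !series_actZ; congr (_ * _).
pose stable (P : weyl K N) := forall Q u,
  series_act (P * Q) g u = series_act P (series_act Q g) u.
have prodS (I : finType) (F : I -> weyl K N) a :
    (forall i Q R u, series_act (Q * R) g =1 series_act Q (series_act R g) ->
      series_act (F i * Q * R) g u = series_act (F i * Q) (series_act R g) u) ->
    forall Q R, (series_act (Q * R) g =1 series_act Q (series_act R g)) ->
    series_act ((\prod_i F i ^+ a i) * Q * R) g
      =1 series_act ((\prod_i F i ^+ a i) * Q) (series_act R g).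
  move=> HF; elim/big_rec: _ => [|i P' _ IH] Q' R' HQ; first by rewrite mul1r.
  move=> v; rewrite -[_ * P' * Q']mulrA.
  elim: (a i) v => [|k IHk] v; first by rewrite mul1r; exact: IH.
  by rewrite exprS -[F i * _ * _]mulrA; apply: HF.
have HX := @prodS 'I_N (@wX K N) (fun i => m (xv i)).
have HD := @prodS 'I_N (@wD K N) (fun i => m (dv i)).
apply: HX => [i Q' R v H|v].
  by rewrite -[wX K i * Q' * R]mulrA !series_act_wX H.
have := HD _ 1 Q; rewrite mulr1; apply=> [i Q' R w H|w].
  by rewrite -[wD K i * Q' * R]mulrA !series_act_wD H.
by rewrite mul1r series_act1.
Qed.

Lemma left_ideal_gen_kills (S : set (weyl K N)) g :
  (forall P, S P -> series_act P g =1 fun=> 0) ->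
  forall P, left_ideal_gen S P -> series_act P g =1 fun=> 0.
Proof.
move=> HS P [s [sS ->]] u; rewrite series_act_sum big_seq big1 // => e es.
rewrite series_act_mul.
rewrite (_ : series_act e.2 g = fun=> 0) ?series_act_zero //.
by apply: funext; apply: HS; apply: sS.
Qed.

End SeriesModule.

(** * The series solution of the modified system *)

Section SeriesSolution.
Variables (K : numFieldType) (d n : nat).
Variables (A : 'M[int]_(d, n)) (w : 'rV[int]_n).
Variables (v : 'I_n -> K) (s : K).
Local Notation D := (weyl K (n + 1)).
Local Notation xi i := (lshift 1 i : 'I_(n + 1)).
Local Notation ti := (rshift n ord0 : 'I_(n + 1)).
Implicit Types (u : 'cV[int]_(n + 1)) (P f l : D) (m : 'X_{1..(n + 1) + (n + 1)}).

(** The variables [x_j] act on basis vectors [e_(v_j + k)] with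
    [d_j e_a = e_(a - 1)] and [x_j e_a = (a + 1) e_(a + 1)], the normalization of
    [x^a / Gamma (a + 1)]: it is free of denominators, hence makes sense also when
    [a] passes through negative integers, where [e_a] behaves as a derivative of
    the delta function. The variable [t] acts on ordinary powers
    [t^(s + k)]. *)
Definition xcoef (i : 'I_(n + 1)) (k : int) : K :=
  match split i with inl j => v j + k%:~R | inr _ => 1 end.

Definition dcoef (i : 'I_(n + 1)) (k : int) : K :=
  match split i with inl _ => 1 | inr _ => s + k%:~R + 1 end.

Lemma xdcoef i k : xcoef i (k + 1) * dcoef i k = xcoef i k * dcoef i (k - 1) + 1.
Proof.
rewrite /xcoef /dcoef; case: (split i) => j; rewrite ?intrD ?intrB /=; ring.
Qed.

Local Notation act := (series_act xcoef dcoef).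

Lemma xcoefx i k : xcoef (xi i) k = v i + k%:~R.
Proof. by rewrite /xcoef (unsplitK (inl _ i)). Qed.
Lemma xcoeft k : xcoef ti k = 1.
Proof. by rewrite /xcoef (unsplitK (inr _ ord0)). Qed.
Lemma dcoefx i k : dcoef (xi i) k = 1.
Proof. by rewrite /dcoef (unsplitK (inl _ i)). Qed.
Lemma dcoeft k : dcoef ti k = s + k%:~R + 1.
Proof. by rewrite /dcoef (unsplitK (inr _ ord0)). Qed.

(** Its kernel consists of the exponents [(u, k)] with [A u = 0] and [k = w u]; the
    sign differs from the homogenized matrix because [t] multiplies where
    the [d_j] differentiate. *)
Definition lattice_mx : 'M[int]_(d + 1, n + 1) := block_mx A 0 w (- 1%:M).

Definition lattice_series u : K := (lattice_mx *m u == 0)%:R.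

Definition dt_shift (a : 'X_{1..n + 1}) : 'cV[int]_(n + 1) :=
  col_mx (usubmx (\col_i (a i)%:Z)) (- dsubmx (\col_i (a i)%:Z)).

Lemma lattice_dt_shift a : lattice_mx *m dt_shift a = tildeA A w *m (\col_i (a i)%:Z).
Proof.
by rewrite -[in RHS](vsubmxK (\col_i (a i)%:Z)) !mul_block_col !mul0mx mulNmx mulmxN opprK.
Qed.

Lemma act_dtX a g u : act (dt_incl ('X_[a] : {mpoly K[n + 1]})) g u = g (u + dt_shift a).
Proof.
rewrite /dt_incl mmapX /mmap1.
pose sg (k : 'I_(n + 1)) : int := match split k with inl _ => 1 | inr _ => -1 end.
have step k P u' : act ((match split k with inl i => opd K i | inr _ => opt K n end) * P) g u'
    = act P g (u' + sg k *: delta_mx k 0).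
  rewrite /sg; case: splitP => j ej.
    have -> : k = xi j by apply: val_inj.
    by rewrite (series_act_wD xdcoef) dcoefx mul1r scale1r.
  have -> : k = ti by apply: val_inj; rewrite /= ej [j]ord1.
  by rewrite series_act_wX xcoeft mul1r scaleN1r.
have -> : dt_shift a = \sum_k (a k)%:Z *: (sg k *: delta_mx k 0).
  apply/colP => j; rewrite summxE (bigD1 j) //= big1 ?addr0.
    rewrite !mxE !eqxx mulr1 /sg; case: splitP => i ei; rewrite !mxE.
      by rewrite mulr1; congr (a _)%:Z; apply: val_inj.
    by rewrite mulrN1; congr (- (a _)%:Z); apply: val_inj.
  by move=> i ij; rewrite !mxE eq_sym (negbTE ij) !mulr0.
elim/big_rec2: _ u => [|k S Q _ IH] u; first by rewrite addr0 series_act1.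
elim: (a k) u => [|e IHe] u; first by rewrite mul1r scale0r add0r.
by rewrite exprS -mulrA step IHe intS scalerDl scale1r !addrA.
Qed.

Lemma act_dt_linear c p q g u :
  act (dt_incl (c *: p + q)) g u = c * act (dt_incl p) g u + act (dt_incl q) g u.
Proof.
rewrite -series_actZ -series_actD /dt_incl mmapD mmapZ /=.
by congr (act (_ + _) _ _); rewrite -scalerAl mul1r.
Qed.

(** All coefficients of the series are [1], and monomials in the [d_j] and [t] only
    translate exponents; the two translations given by a binomial of the toric
    ideal differ by a vector of the kernel. *)
Lemma toric_kills (f : {mpoly K[n + 1]}) : toric_ideal A w f ->
  act (dt_incl f) lattice_series =1 fun=> 0.
Proof.
move=> [e [eS ->]] u; rewrite big_seq.
elim/big_rec: _ => [|k p ke IH]; first by rewrite /dt_incl mmap0 series_act0.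
rewrite -[_ * _]scale1r act_dt_linear IH addr0 mul1r.
have [a [b [ab ->]]] := eS _ ke.
elim/mpolyind: k.1 => [|c m q _ _ IHq]; first by rewrite mul0r /dt_incl mmap0 series_act0.
rewrite mulrDl -scalerAl act_dt_linear IHq addr0 mulrBr -!mpolyXD.
rewrite -[_ - _]addrC -scaleN1r act_dt_linear !act_dtX mulN1r.
rewrite /lattice_series !mulmxDr !lattice_dt_shift.
have tD x y : tildeA A w *m (\col_i ((x + y)%MM i)%:Z) =
    tildeA A w *m (\col_i (x i)%:Z) + tildeA A w *m (\col_i (y i)%:Z).
  by rewrite -mulmxDr; congr (_ *m _); apply/colP => i; rewrite !mxE mnmDE.
by rewrite !tD ab addNr mulr0.
Qed.

Lemma act_theta i g u :
  act (opx K i * opd K i) g u = (v i + (u (xi i) 0)%:~R) * g u.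
Proof.
rewrite series_act_wX.
rewrite -[opd K i]mulr1 (series_act_wD xdcoef).
by rewrite series_act1 xcoefx dcoefx mul1r subrK.
Qed.

Lemma act_theta_t P g u :
  act (opt K n * opdt K n * P) g u = (s + (u ti 0)%:~R) * act P g u.
Proof.
rewrite -mulrA series_act_wX.
rewrite (series_act_wD xdcoef).
rewrite xcoeft dcoeft mul1r subrK; congr (_ * _).
by rewrite !mxE !eqxx intrB /=; ring.
Qed.

Lemma latticeP u : lattice_series u != 0 ->
  A *m usubmx u = 0 /\ w *m usubmx u = dsubmx u.
Proof.
rewrite /lattice_series; case: (lattice_mx *m u =P 0) => [|_]; last by rewrite mulr0n eqxx.
rewrite -[u in lattice_mx *m u]vsubmxK mul_block_col mul0mx addr0 mulNmx mul1mx.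
move=> e _; have : col_mx (A *m usubmx u) (w *m usubmx u - dsubmx u) = col_mx 0 0.
  by rewrite e col_mx0.
by case/eq_col_mx => -> /eqP; rewrite subr_eq0 => /eqP.
Qed.

(** The Euler operators act diagonally, and their eigenvalues vanish on the support
    of the series, because [A (v + u) = A v] there. *)
Lemma HAw_kills (beta : 'cV[K]_d) :
  map_mx intr A *m (\col_i v i) = beta -> s = \sum_i (w 0 i)%:~R * v i ->
  forall P, HAw A w beta P -> act P lattice_series =1 fun=> 0.
Proof.
move=> Av sv; apply: (left_ideal_gen_kills xdcoef).
move=> P [[[i ->]|->]|[f tf <-]] u; last exact: toric_kills.
- rewrite series_actB series_act_sum series_actZ series_act1.
  under eq_bigr do rewrite series_actZ act_theta mulrA.
  rewrite -mulr_suml -mulrBl.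
  have [->|/latticeP[Au _]] := eqVneq (lattice_series u) 0; first by rewrite mulr0.
  rewrite (_ : _ - _ = 0) ?mul0r //.
  under eq_bigr do rewrite mulrDr.
  rewrite big_split /= -Av mxE.
  under [X in _ - X]eq_bigr do rewrite !mxE.
  rewrite addrAC subrr add0r.
  have /(congr1 (fun z : 'cV[int]_d => (z i 0)%:~R : K)) := Au.
  rewrite !mxE mulr0z rmorph_sum /= => e0; rewrite -[RHS]e0.
  by apply: eq_bigr => j _; rewrite !mxE intrM.
- rewrite series_actB series_act_sum -[opt _ _ * _]mulr1 act_theta_t series_act1.
  under eq_bigr do rewrite series_actZ act_theta mulrA.
  rewrite -mulr_suml -mulrBl.
  have [->|/latticeP[_ wu]] := eqVneq (lattice_series u) 0; first by rewrite mulr0.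
  rewrite (_ : _ - _ = 0) ?mul0r //.
  under eq_bigr do rewrite mulrDr.
  rewrite big_split /= -sv opprD addrACA subrr add0r.
  have /(congr1 (fun z : 'cV[int]_1 => (z 0 0)%:~R : K)) := wu.
  rewrite !mxE rmorph_sum /= => <-.
  apply/eqP; rewrite subr_eq0; apply/eqP.
  by apply: eq_bigr => j _; rewrite !mxE intrM.
Qed.

Lemma weight_tau m : weight (@tau_x n) (@tau_d n) m = mshift m ti 0.
Proof.
rewrite /weight (bigD1 ti) //= big1 ?addr0.
  by rewrite /tau_x /tau_d eqxx mxE; ring.
by move=> i; rewrite /tau_x /tau_d => /negbTE ->; rewrite !mul0r addr0.
Qed.

Section Leading.
Variables (b : 'I_n -> nat) (sigma : {set 'I_n}).
Hypothesis vb : forall i, i \notin sigma -> v i = (b i)%:R.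

Definition in_region u := forall i, i \notin sigma -> 0 <= (b i)%:Z + u (xi i) 0.

(** Off [sigma] the coefficients of negative powers of [x] are never fed into
    those of nonnegative powers, because [x_i] multiplies the coefficient of
    [x_i^(-1)] by zero. *)
Lemma mcoef_region m u : in_region u -> mcoef xcoef dcoef m u != 0 ->
  in_region (u + mshift m).
Proof.
move=> ru nz i is_; move: (nz); rewrite /mcoef (bigD1 (xi i)) //= mulf_eq0 negb_or.
rewrite mulf_eq0 negb_or => /andP[/andP[cnz _] _].
have := ru i is_; rewrite !mxE addrA addrCA.
set X := (b i)%:Z + u (xi i) 0; set e := m (lshift (n + 1) (xi i)) in cnz *.
case: (leP e%:Z X) => [le _|lt ge].
  by rewrite addr_ge0 // subr_ge0.
case/negP: cnz; rewrite /cpow.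
have lj : (absz X < e)%N by rewrite -ltz_nat gez0_abs.
rewrite (bigD1 (Ordinal lj)) //= mulf_eq0; apply/orP; left.
rewrite xcoefx (vb is_) -[(b i)%:R]/((b i)%:Z%:~R) -intrD gez0_abs //.
by rewrite addrA subrr.
Qed.

Definition leading_series u : K := lattice_series u * (u ti 0 == 0)%:R.

Hypothesis region_pos : forall u, in_region u -> lattice_series u != 0 -> 0 <= u ti 0.

(** Comparing the coefficients of the lowest power of [t]: if [l] kills the
    series, then the initial form of [l] kills its leading part. *)
Lemma initial_form_kills l u : l != 0 -> (forall u', act l lattice_series u' = 0) ->
  in_region u -> act (initial_form (@tau_x n) (@tau_d n) l) leading_series u = 0.
Proof.
move=> l0 lk ru; rewrite /initial_form /series_act /=.
set ms := msupp (symbol l); set phi := fun m => _.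
have ->: mlin (phi : _ -> K^o) (\sum_(m <- ms | all (fun m' => weight (@tau_x n) (@tau_d n) m'
      <= weight (@tau_x n) (@tau_d n) m) ms) (symbol l)@_m *: 'X_[m]) =
    \sum_(m <- ms | all (fun m' => weight (@tau_x n) (@tau_d n) m'
      <= weight (@tau_x n) (@tau_d n) m) ms) (symbol l)@_m * phi m.
  elim/big_rec2: _ => [|m y p _ <-]; first exact: mlin0.
  by rewrite mlinD mlinZ mlinX.
have [->|[m0 m0s /allP m0x]] :
    \sum_(m <- ms | all (fun m' => weight (@tau_x n) (@tau_d n) m'
      <= weight (@tau_x n) (@tau_d n) m) ms) (symbol l)@_m * phi m = 0 \/
    exists2 m0, m0 \in ms & all (fun m' => weight (@tau_x n) (@tau_d n) m'
      <= weight (@tau_x n) (@tau_d n) m0) ms.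
- have [h|h] := boolP (has (fun m0 => all (fun m' => weight (@tau_x n) (@tau_d n) m'
      <= weight (@tau_x n) (@tau_d n) m0) ms) ms); first by right; apply/hasP.
  left; rewrite big_seq_cond big1 // => m /andP[ms_ al].
  by case/negP: h; apply/hasP; exists m.
- by [].
set om := weight _ _ m0 in m0x.
have [uo|uo] := eqVneq (u ti 0) (- om); last first.
  rewrite big_seq_cond big1 // => m /andP[ms_ /allP al].
  rewrite /phi /leading_series mxE -weight_tau.
  have -> : weight (@tau_x n) (@tau_d n) m = om.
    by apply/eqP; rewrite eq_le m0x //=; apply: al.
  by rewrite addr_eq0 (negbTE uo) !mulr0.
rewrite -{2}(lk u) /series_act /mlin -/ms big_mkcond /= !big_seq.
apply: eq_bigr => m ms_; rewrite /phi /leading_series.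
have -> : (u + mshift m) ti 0 = weight (@tau_x n) (@tau_d n) m - om.
  by rewrite mxE -weight_tau uo addrC.
have := m0x m ms_; rewrite le_eqVlt => /orP[/eqP e|lt].
  rewrite e subrr eqxx mulr1 ifT //; apply/allP => m' ms'; exact: m0x.
rewrite ifF; last by apply/negbTE/allPn; exists m0 => //; rewrite -ltNge.
apply/esym/eqP; have [->|nz] := eqVneq (mcoef xcoef dcoef m u) 0.
  by rewrite mul0r scaler0.
have [->|lz] := eqVneq (lattice_series (u + mshift m)) 0; first by rewrite mulr0 scaler0.
have := region_pos (mcoef_region ru nz) lz.
by rewrite mxE -weight_tau uo addrC subr_ge0 leNgt lt.
Qed.

Lemma in_tau_kills (I : set D) f u :
  (forall l, I l -> act l lattice_series =1 fun=> 0) ->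
  in_tau I f -> in_region u -> act f leading_series u = 0.
Proof.
move=> kI [e [eI ->]] ru; rewrite series_act_sum big_seq big1 // => k ke.
rewrite series_actZ; have [l [Il l0 ->]] := eI _ ke.
by rewrite initial_form_kills ?mulr0 //; apply: kI.
Qed.

Lemma leading_series0 : leading_series 0 = 1.
Proof. by rewrite /leading_series /lattice_series mulmx0 mxE !eqxx mulr1. Qed.

Lemma in_region0 : in_region 0.
Proof. by move=> i _; rewrite mxE; lia. Qed.

Lemma act_ev p g u : act (horner_alg (opt K n * opdt K n) p) g u
  = p.[s + (u ti 0)%:~R] * g u.
Proof.
elim/poly_ind: p => [|p c IH]; first by rewrite rmorph0 series_act0 horner0 mul0r.
rewrite mulrC rmorphD rmorphM /= horner_algX horner_algC series_actD act_theta_t IH.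
by rewrite series_actZ series_act1 !hornerE mulrDl.
Qed.

End Leading.
End SeriesSolution.

(** * Homogeneous parts and initial ideals *)

Section InitialIdealClosure.
Variables (K : fieldType) (n : nat).
Local Notation D := (weyl K (n + 1)).
Local Notation wt := (weight (@tau_x n) (@tau_d n)).
Local Notation ti := (rshift n ord0 : 'I_(n + 1)).
Implicit Types (f g l : D) (W : int -> bool) (I : set D).

Definition wt_in W f := forall m, m \in msupp (symbol f) -> W (wt m).

Lemma wtD (m1 m2 : 'X_{1..(n + 1) + (n + 1)}) : wt (m1 + m2) = wt m1 + wt m2.
Proof.
by rewrite /weight -big_split; apply: eq_bigr => i _; rewrite /= !mnmDE !PoszD; ring.
Qed.

Lemma wtx i : wt U_(lshift (n + 1) i) = tau_x i.
Proof.
rewrite /weight (bigD1 i) //= big1 ?addr0.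
  by rewrite !mnm1E eqxx eq_lrshift mulr1 mulr0 addr0.
move=> j ji; rewrite !mnm1E eq_lshift eq_lrshift eq_sym (negbTE ji).
by rewrite !mulr0 addr0.
Qed.

Lemma wtd i : wt U_(rshift (n + 1) i) = tau_d i.
Proof.
rewrite /weight (bigD1 i) //= big1 ?addr0.
  by rewrite !mnm1E eqxx eq_rlshift mulr1 mulr0 add0r.
move=> j ji; rewrite !mnm1E eq_rshift eq_rlshift eq_sym (negbTE ji).
by rewrite !mulr0 addr0.
Qed.

Lemma wt_in0 W : wt_in W 0.
Proof. by move=> m; rewrite msupp0. Qed.

Lemma wt_inD W f g : wt_in W f -> wt_in W g -> wt_in W (f + g).
Proof.
by move=> Wf Wg m /msuppD_le; rewrite mem_cat => /orP[/Wf|/Wg].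
Qed.

Lemma wt_inZ W a f : wt_in W f -> wt_in W (a *: f).
Proof. by move=> Wf m /msuppZ_le/Wf. Qed.

Lemma msuppXM k i (p : {mpoly K[k]}) m :
  m \in msupp ('X_i * p) -> exists2 m', m' \in msupp p & m = (U_(i) + m')%MM.
Proof.
by rewrite mulrC (perm_mem (msuppMX _ _)) => /mapP[m' pm' ->]; exists m'.
Qed.

Lemma msupp_mderiv k i (p : {mpoly K[k]}) m :
  m \in msupp (p^`M(i)) -> (U_(i) + m)%MM \in msupp p.
Proof.
rewrite !mcoeff_msupp mcoeff_mderiv addmC; apply: contra => /eqP ->.
by rewrite mul0rn.
Qed.

Lemma wt_in_opx W i f : wt_in W f -> wt_in W (opx K i * f).
Proof.
move=> Wf m; rewrite symbolX_mul => /msuppXM[m' /Wf Wm ->].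
by rewrite wtD wtx /tau_x eq_lrshift add0r.
Qed.

Lemma wt_in_opd W i f : wt_in W f -> wt_in W (opd K i * f).
Proof.
move=> Wf m; rewrite symbolD_mul => /msuppD_le.
rewrite mem_cat => /orP[/msuppXM[m' /Wf Wm ->]|/msupp_mderiv/Wf].
  by rewrite wtD wtd /tau_d eq_lrshift add0r.
by rewrite wtD wtx /tau_x eq_lrshift add0r.
Qed.

Lemma wt_in_theta_t W f : wt_in W f -> wt_in W (opt K n * opdt K n * f).
Proof.
move=> Wf m; rewrite -mulrA symbolX_mul symbolD_mul => /msuppXM[m1 + ->].
move/msuppD_le; rewrite mem_cat => /orP[/msuppXM[m' /Wf Wm ->]|/msupp_mderiv/Wf //].
by rewrite !wtD wtd wtx /tau_d /tau_x eqxx addrA addNr add0r.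
Qed.

(** An element is recovered as an initial form once it is homogeneous of weight [0]
    and [l] exceeds it by terms of negative weight only. *)
Lemma initial_form_eq l f : f != 0 -> wt_in (pred1 0) f ->
  wt_in (fun k => k < 0) (l - f) ->
  l != 0 /\ initial_form (@tau_x n) (@tau_d n) l = f.
Proof.
move=> f0 Wf Wr.
have r_ m : ~~ (wt m < 0) -> (symbol l)@_m = (symbol f)@_m.
  move=> h; have : m \notin msupp (symbol (l - f)) by apply: contra h => /Wr.
  rewrite mcoeff_msupp negbK => /eqP e.
  by apply/eqP; rewrite -subr_eq0 -mcoeffB; apply/eqP; exact: e.
have f_ m : wt m != 0 -> (symbol f)@_m = 0.
  by move=> h; apply/eqP; rewrite -[_ == _]negbK -mcoeff_msupp; apply: contra h => /Wf.
have le0 m : m \in msupp (symbol l) -> wt m <= 0.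
  rewrite mcoeff_msupp; apply: contraNT; rewrite -ltNge => h.
  by rewrite r_ ?f_ // ?gt_eqF // -leNgt ltW.
have [m0 m0f] : exists m0, m0 \in msupp (symbol f).
  case E: (msupp (symbol f)) => [|m0 ?]; last by exists m0; rewrite inE eqxx.
  by case/eqP: f0; apply: symbolP; apply: msuppnil0.
have w0 : wt m0 = 0 by apply/eqP; apply: (Wf).
have m0l : m0 \in msupp (symbol l).
  by rewrite mcoeff_msupp r_ ?w0 // -mcoeff_msupp.
split; first by apply: contraTneq m0l => ->; rewrite msupp0.
apply: symbolP; rewrite /=; apply/mpolyP => m.
rewrite [LHS]raddf_sum /=; under eq_bigr do rewrite mcoeffZ mcoeffX.
have [wm|wm] := eqVneq (wt m) 0; last first.
  rewrite f_ // big_seq_cond big1 // => m' /andP[_ /allP al].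
  case: eqP => [e|]; last by rewrite mulr0.
  have := al m0 m0l; rewrite e w0 => h.
  rewrite (_ : (symbol l)@_m = 0) ?mul0r //; apply/eqP.
  rewrite -[_ == _]negbK -mcoeff_msupp; apply/negP => /le0 h2.
  by case/eqP: wm; apply/eqP; rewrite eq_le h h2.
rewrite -r_ ?wm //.
have [ml|ml] := boolP (m \in msupp (symbol l)).
  rewrite -big_filter (bigD1_seq m) ?filter_uniq ?msupp_uniq //=.
    by rewrite eqxx mulr1 big1 ?addr0 // => m' /negbTE ->; rewrite mulr0.
  by rewrite mem_filter ml andbT; apply/allP => m' /le0; rewrite wm.
rewrite (memN_msupp_eq0 ml) big_seq_cond big1 // => m' /andP[ml' _].
by case: eqP => [e|]; rewrite ?mulr0 // -e ml' in ml *.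
Qed.

(** For [f] of weight [0], a replacement for being the initial form of an element
    of [I] that is stable under sums and under left multiplication by operators of
    weight [0]; initial forms are not, because leading terms may cancel. *)
Definition lifts I f := exists2 l, I l & wt_in (fun k => k < 0) (l - f).

Lemma lifts_in_tau I f : wt_in (pred1 0) f -> lifts I f -> in_tau I f.
Proof.
move=> Wf [l Il Wr]; have [->|f0] := eqVneq f 0; first by exists [::]; rewrite big_nil.
have [l0 e] := initial_form_eq f0 Wf Wr.
exists [:: (1, f)]; split; last by rewrite big_seq1 scale1r.
by move=> c; rewrite inE => /eqP ->; exists l.
Qed.

Variable S : set D.
Let I := left_ideal_gen S.

Lemma ideal0 : I 0.
Proof. by exists [::]; rewrite big_nil. Qed.

Lemma idealD f g : I f -> I g -> I (f + g).
Proof.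
move=> [s [sS ->]] [r [rS ->]]; exists (s ++ r); split; last by rewrite big_cat.
by move=> c; rewrite mem_cat => /orP[/sS|/rS].
Qed.

Lemma idealM h f : I f -> I (h * f).
Proof.
move=> [s [sS ->]]; exists [seq (h * c.1, c.2) | c <- s]; split.
  by move=> _ /mapP[c cs ->] /=; apply: sS.
by rewrite big_map mulr_sumr; apply: eq_bigr => c _; rewrite mulrA.
Qed.

Lemma ideal_gen f : S f -> I f.
Proof.
move=> Sf; exists [:: (1, f)]; split; last by rewrite big_seq1 mul1r.
by move=> c; rewrite inE => /eqP ->.
Qed.

Lemma lifts_ideal f : I f -> lifts I f.
Proof. by move=> If; exists f => //; rewrite subrr; exact: wt_in0. Qed.

Lemma liftsD f g : lifts I f -> lifts I g -> lifts I (f + g).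
Proof.
move=> [l1 I1 W1] [l2 I2 W2]; exists (l1 + l2); first exact: idealD.
by rewrite opprD addrACA; apply: wt_inD.
Qed.

Lemma liftsZ a f : lifts I f -> lifts I (a *: f).
Proof.
move=> [l Il W]; exists (a *: l); last by rewrite -scalerBr; apply: wt_inZ.
by rewrite -[l]mul1r scalerAl; apply: idealM.
Qed.

Lemma lifts_opx i f : lifts I f -> lifts I (opx K i * f).
Proof.
move=> [l Il W]; exists (opx K i * l); first exact: idealM.
by rewrite -mulrBr; apply: wt_in_opx.
Qed.

Lemma lifts_opd i f : lifts I f -> lifts I (opd K i * f).
Proof.
move=> [l Il W]; exists (opd K i * l); first exact: idealM.
by rewrite -mulrBr; apply: wt_in_opd.
Qed.

Lemma lifts_theta_t f : lifts I f -> lifts I (opt K n * opdt K n * f).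
Proof.
move=> [l Il W]; exists (opt K n * opdt K n * l); first exact: idealM.
by rewrite -mulrBr; apply: wt_in_theta_t.
Qed.

End InitialIdealClosure.

(** * The initial monomial ideal and optimal exponents *)

Section OptimalExponents.
Variables (d n : nat) (A : 'M[int]_(d, n)) (w : 'rV[int]_n).
Implicit Types (a b c : 'X_{1..n}).

Definition zcol a : 'cV[int]_n := \col_i (a i)%:Z.
Definition cost a : int := (w *m zcol a) 0 0.

(** Minimal cost in the fibre of [A]: the monomials outside the initial ideal are
    the optimal ones, since the toric ideal is graded by these fibres. *)
Definition optimal a := forall a', A *m zcol a' = A *m zcol a -> cost a <= cost a'.

Lemma zcolD a b : zcol (a + b) = zcol a + zcol b.
Proof. by apply/colP => i; rewrite !mxE mnmDE. Qed.

Lemma costD a b : cost (a + b) = cost a + cost b.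
Proof. by rewrite /cost zcolD mulmxDr mxE. Qed.

Lemma not_optimalP a : ~ optimal a ->
  exists2 a', A *m zcol a' = A *m zcol a & cost a' < cost a.
Proof.
by move=> /existsNP[a' /not_implyP[e /negP]]; rewrite -ltNge; exists a'.
Qed.

Lemma optimal_addl a c : optimal (a + c)%MM -> optimal a.
Proof.
move=> o a' e; have := o (a' + c)%MM; rewrite !costD lerD2r; apply.
by rewrite !zcolD !mulmxDr e.
Qed.

Lemma optimal_le a b : (a <= b)%MM -> optimal b -> optimal a.
Proof. by move=> /submK <-; rewrite addmC; exact: optimal_addl. Qed.

Variable K : numFieldType.
Local Notation D := (weyl K (n + 1)).
Local Notation ti := (rshift n ord0 : 'I_(n + 1)).

Definition toric_left_ideal : set D := left_ideal_gen (@dt_incl K n @` toric_ideal A w)%classic.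

Definition opd_mon a : D := \prod_i opd K i ^+ a i.

Definition mext a (k : nat) : 'X_{1..n + 1} :=
  [multinom (match split i with inl j => a j | inr _ => k end) | i < n + 1].

Lemma dt_incl_mext a k :
  dt_incl ('X_[mext a k] : {mpoly K[n + 1]}) = opd_mon a * opt K n ^+ k.
Proof.
rewrite /dt_incl mmapX /mmap1 big_split_ord big_ord1 /=; congr (_ * _).
  by apply: eq_bigr => i _; rewrite mnmE (unsplitK (inl _ i)).
by rewrite mnmE (unsplitK (inr _ ord0)).
Qed.

Lemma toric_binomial a a' k : A *m zcol a' = A *m zcol a ->
  cost a = cost a' + k%:Z ->
  toric_left_ideal (opd_mon a - opd_mon a' * opt K n ^+ k).
Proof.
move=> eA ec; apply: ideal_gen; exists ('X_[mext a 0] - 'X_[mext a' k]); last first.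
  by rewrite -dt_incl_mext -[opd_mon a]mulr1 -(dt_incl_mext a 0); exact: mmapB.
exists [:: (1, 'X_[mext a 0] - 'X_[mext a' k])]; split; last by rewrite big_seq1 mul1r.
move=> c; rewrite inE => /eqP -> /=; exists (mext a 0), (mext a' k); split=> //.
have ext e j : \col_i ((mext e j i)%:Z) = col_mx (zcol e) (j%:Z%:M : 'cV[int]_1).
  apply/colP => i; rewrite !mxE mnmE; case: split => i'; rewrite !mxE //.
  by rewrite [i']ord1.
rewrite !ext !mul_block_col !mul0mx !addr0 eA !mul1mx; congr col_mx.
apply/colP => k0; rewrite [k0]ord1 mxE [RHS]mxE -/(cost a) -/(cost a') ec.
by rewrite !mxE eqxx /= !mulr1n addr0.
Qed.

Lemma opd_mon_wt a : wt_in (pred1 0) (opd_mon a).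
Proof.
rewrite /opd_mon; elim/big_rec: _ => [m|i f _ IH].
  rewrite [symbol 1](_ : _ = 1) // msupp1 inE => /eqP ->.
  by apply/eqP; rewrite /weight big1 // => i _; rewrite !mnm0E !mulr0 addr0.
elim: (a i) => [|k IHk]; first by rewrite mul1r.
by rewrite exprS -mulrA; apply: wt_in_opd.
Qed.

Lemma opd_mon_opt_wt a k : (0 < k)%N ->
  wt_in (fun e => e < 0) (opd_mon a * opt K n ^+ k).
Proof.
move=> k0; rewrite /opd_mon.
elim/big_rec: _ => [|i f _ IH]; last first.
  elim: (a i) => [|j IHj]; first by rewrite mul1r.
  by rewrite exprS -!mulrA; apply: wt_in_opd; rewrite mulrA.
rewrite mul1r => m.
have -> : symbol (opt K n ^+ k) = 'X_[U_(lshift (n + 1) ti) *+ k].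
  elim: k {k0} => [|k IH]; first by rewrite mulm0n mpolyX0.
  by rewrite exprS symbolX_mul IH -mpolyXD mulmS.
rewrite msuppX inE => /eqP ->.
have -> : weight (@tau_x n) (@tau_d n) (U_(lshift (n + 1) ti) *+ k) = - k%:Z.
  elim: k {k0} => [|k IH].
    by rewrite mulm0n /weight big1 // => i _; rewrite !mnm0E !mulr0 addr0.
  by rewrite mulmS wtD wtx IH /tau_x eqxx intS opprD.
by rewrite oppr_lt0 ltz_nat.
Qed.

(** A cheaper exponent [a'] of the same fibre gives the toric binomial
    [d^a - d^a' t^k] with [k > 0], whose initial form is [d^a]. *)
Lemma not_optimal_lifts a : ~ optimal a -> lifts toric_left_ideal (opd_mon a).
Proof.
move=> /not_optimalP[a' eA lt]; have k0 : (0 < absz (cost a - cost a'))%N.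
  by rewrite absz_gt0 subr_eq0 gt_eqF.
exists (opd_mon a - opd_mon a' * opt K n ^+ absz (cost a - cost a')).
  by apply: toric_binomial => //; rewrite gez0_abs ?subr_ge0 1?ltW // subrKC.
rewrite addrAC subrr sub0r -scaleN1r; apply: wt_inZ; exact: opd_mon_opt_wt.
Qed.

(** The exponential series of the fibre of [a] certifies the converse: its part
    of lowest order in [t] is not killed by the monomial of [a]. *)
Lemma in_tau_toric a : in_tau toric_left_ideal (opd_mon a) <-> ~ optimal a.
Proof.
split=> [Ja opt_a|/not_optimal_lifts]; last by apply: lifts_in_tau; exact: opd_mon_wt.
pose v i : K := (a i)%:R.
have pos u : in_region a finset.set0 u -> lattice_series K A w u != 0 -> 0 <= u ti 0.
  move=> ru /latticeP[Au wu].
  pose a' : 'X_{1..n} := [multinom absz ((a i)%:Z + u (lshift 1 i) 0)%R | i < n].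
  have ea : zcol a' = zcol a + usubmx u.
    by apply/colP => i; rewrite !mxE mnmE gez0_abs //; apply: ru; rewrite inE.
  have := opt_a a'; rewrite ea mulmxDr Au addr0 => /(_ erefl).
  by rewrite /cost ea mulmxDr wu [X in _ <= X]mxE lerDl mxE.
have kills (l : D) : toric_left_ideal l ->
    series_act (xcoef v) (dcoef 0) l (lattice_series K A w) =1 fun=> 0.
  apply: (left_ideal_gen_kills (xdcoef v 0)) => P [f tf <-] u; exact: toric_kills.
(* The monomial of [a] moves the exponent [0] to the point [- a]. *)
pose u : 'cV[int]_(n + 1) := col_mx (- zcol a) 0.
have ru : in_region a finset.set0 u by move=> i _; rewrite col_mxEu !mxE subrr.
have := in_tau_kills (sigma := finset.set0) (b := a) (v := v) (fun i _ => erefl) pos kills Ja ru.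
rewrite (_ : opd_mon a = dt_incl 'X_[mext a 0]); last by rewrite dt_incl_mext mulr1.
rewrite act_dtX (_ : u + _ = 0) ?leading_series0 => [/eqP|]; first by rewrite oner_eq0.
apply/colP => i; rewrite !mxE; case: split => j; rewrite !mxE mnmE.
  by rewrite (unsplitK (inl _ j)) addNr.
by rewrite (unsplitK (inr _ j)) oppr0 addr0.
Qed.

Lemma monomial_inP c : (monomial_in A w : set {mpoly K[n]}) 'X_[c] <-> ~ optimal c.
Proof.
split=> [[s [sS e]]|no]; last first.
  exists [:: (1, 'X_[c])]; split; last by rewrite big_seq1 mul1r.
  by move=> k; rewrite inE => /eqP ->; exists c => //; apply/in_tau_toric.
have: c \in msupp ('X_[c] : {mpoly K[n]}) by rewrite msuppX inE.
rewrite e => /msupp_sum_le; rewrite filter_predT => /flattenP[_ /mapP[k ks ->]].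
have [a -> /in_tau_toric noa] := sS k ks.
rewrite (perm_mem (msuppMX _ _)) => /mapP[m _ ->].
by move/optimal_addl.
Qed.

End OptimalExponents.

(** * Falling factorials *)

Section FallingFactorial.
Variables (K : numFieldType) (N : nat).
Implicit Types (a b m : 'X_{1..N}) (f : {mpoly K[N]}).

Definition ffp a : {mpoly K[N]} := \prod_i \prod_(j < a i) ('X_i - j%:R%:MP).

Lemma ffp0 : ffp 0 = 1.
Proof. by rewrite /ffp big1 // => i _; rewrite mnm0E big_ord0. Qed.

Lemma ffp_mulX i a : 'X_i * ffp a = ffp (U_(i) + a) + (a i)%:R *: ffp a.
Proof.
rewrite /ffp (bigD1 i) // [in X in _ = X + _](bigD1 i) //=.
rewrite [X in _ * X + _](_ : _ = \prod_(j | j != i) \prod_(k < a j) ('X_j - k%:R%:MP)).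
  rewrite mnmDE mnm1E eqxx add1n big_ord_recr /= -mul_mpolyC; ring.
apply: eq_bigr => j ji; rewrite mnmDE mnm1E.
by rewrite (negbTE (_ : i != j)) 1?eq_sym.
Qed.

Lemma ffp_span f : exists p, f = mlin ffp p.
Proof.
pose im f := exists p, f = mlin ffp p.
have imX i g : im g -> im ('X_i * g).
  move=> [p ->]; elim/mpolyind: p => [|c m p _ _ [q e]].
    by exists 0; rewrite !mlin0 mulr0.
  exists (c *: ('X_[U_(i) + m] + (m i)%:R *: 'X_[m]) + q).
  rewrite !mlinP mulrDr e; congr (_ + _).
  by rewrite mlinD mlinZ !mlinX -ffp_mulX scalerAr.
elim/mpolyind: f => [|c m f _ _ [q ->]]; first by exists 0; rewrite mlin0.
have [p ->] : im 'X_[m].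
  rewrite mpolyXE_id; elim/big_rec: _ => [|i g _ IH].
    by exists 'X_[0]; rewrite mlinX ffp0.
  elim: (m i) => [|k IHk]; first by rewrite mul1r.
  by rewrite exprS -mulrA; apply: imX.
by exists (c *: p + q); rewrite mlinP.
Qed.

Lemma ffp_eval a b : (ffp a).@[fun i => (b i)%:R]
  = \prod_i \prod_(j < a i) ((b i)%:R - j%:R).
Proof.
rewrite rmorph_prod; apply: eq_bigr => i _; rewrite rmorph_prod.
by apply: eq_bigr => j _; rewrite /= mevalB mevalXU mevalC.
Qed.

Lemma ffp_eval_eq0 a b : ~~ (a <= b)%MM -> (ffp a).@[fun i => (b i)%:R] = 0.
Proof.
rewrite negb_forall => /existsP[i0]; rewrite -ltnNge => lt; rewrite ffp_eval.
by rewrite (bigD1 i0) //= (bigD1 (Ordinal lt)) //= subrr !mul0r.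
Qed.

Lemma ffp_eval_neq0 a : (ffp a).@[fun i => (a i)%:R] != 0.
Proof.
rewrite ffp_eval; apply/prodf_neq0 => i _; apply/prodf_neq0 => j _.
by rewrite subr_eq0 eqr_nat neq_ltn ltn_ord orbT.
Qed.

(** Newton interpolation: the coefficients of a polynomial on the falling
    factorials are determined from below by its values at natural points, so a
    polynomial that vanishes off an up-closed set only involves the falling
    factorials indexed by that set. *)
Lemma ffp_vanishing (U : 'X_{1..N} -> Prop) (J : {mpoly K[N]} -> Prop) f :
  (forall a b, (a <= b)%MM -> U a -> U b) ->
  J 0 -> (forall c g h, J g -> J h -> J (c *: g + h)) ->
  (forall a, U a -> J (ffp a)) ->
  (forall a, ~ U a -> f.@[fun i => (a i)%:R] = 0) -> J f.
Proof.
move=> Uup J0 JP JU; have [p ->] := ffp_span f => f0.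
have p0 a : ~ U a -> p@_a = 0.
  have [k] := ubnP (mdeg a); elim: k a => // k IH a; rewrite ltnS => ak nUa.
  have := f0 a nUa; rewrite /mlin raddf_sum /=.
  under eq_bigr do rewrite mevalZ.
  have [ap|/memN_msupp_eq0 //] := boolP (a \in msupp p).
  rewrite (bigD1_seq a) ?msupp_uniq //= big1_seq ?addr0.
    by move/eqP; rewrite mulf_eq0 (negbTE (ffp_eval_neq0 a)) orbF => /eqP.
  move=> b /andP[ba _]; have [le|nle] := boolP (b <= a)%MM; last first.
    by rewrite ffp_eval_eq0 ?mulr0.
  rewrite IH ?mul0r //; last by move/(Uup _ _ le).
  apply: leq_trans ak; rewrite -(submK le) mdegD -[X in (X < _)%N]add0n ltn_add2r.
  rewrite lt0n mdeg_eq0; apply: contra ba => /eqP e.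
  by rewrite -(submK le) e add0m.
rewrite /mlin; elim: (msupp p) => [|a s IH]; first by rewrite big_nil.
rewrite big_cons; have [Ua|nUa] := pselect (U a); first by apply: JP => //; exact: JU.
by rewrite p0 // scale0r add0r.
Qed.

End FallingFactorial.

(** * Polynomials in the Euler operators *)

Section EulerOperators.
Variables (K : numFieldType) (n : nat).
Local Notation D := (weyl K (n + 1)).
Local Notation ti := (rshift n ord0 : 'I_(n + 1)).
Implicit Types (f g : {mpoly K[n + 1]}) (m : 'X_{1..n + 1}).

Definition euler (i : 'I_(n + 1)) : D := wX K i * wD K i.

Lemma symbol_euler i (P : D) : symbol (euler i * P) =
  'X_(lshift (n + 1) i) * ('X_(rshift (n + 1) i) * symbol P
                          + (symbol P)^`M(lshift (n + 1) i)).
Proof. by rewrite -mulrA symbolX_mul symbolD_mul. Qed.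

Lemma eulerC i j : euler i * euler j = euler j * euler i.
Proof.
have [->//|ij] := eqVneq i j.
rewrite /euler -[LHS]mulrA (mulrA (wD K i)) wDX (negbTE ij) addr0.
rewrite -[RHS]mulrA (mulrA (wD K j)) wDX eq_sym (negbTE ij) addr0.
by rewrite -!mulrA (mulrA (wX K i)) wXC -!mulrA wDC.
Qed.

Definition Theta f : D := mmap (in_alg D) euler f.

Lemma ThetaP c f g : Theta (c *: f + g) = c *: Theta f + Theta g.
Proof. by rewrite /Theta mmapD mmapZ /= -scalerAl mul1r. Qed.

Lemma Theta0 : Theta 0 = 0. Proof. exact: mmap0. Qed.

Lemma mmap1_euler i m : mmap1 euler (U_(i) + m) = euler i * mmap1 euler m.
Proof.
rewrite /mmap1; have : i \in index_enum 'I_(n + 1) by rewrite mem_index_enum.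
have : uniq (index_enum 'I_(n + 1)) by rewrite index_enum_uniq.
elim: (index_enum _) => // j s IH /= /andP[js us]; rewrite !big_cons in_cons mnmDE mnm1E.
case: (i =P j) => [ij|/eqP ij] /= => [_|is_].
  rewrite -{j}ij in js *; rewrite add1n exprS -mulrA; congr (_ * (_ * _)); rewrite big_seq [RHS]big_seq.
  apply: eq_bigr => k ks; rewrite mnmDE mnm1E.
  by case: eqP js => // ->; rewrite ks.
rewrite IH // add0n mulrA.
suff -> : euler j ^+ m j * euler i = euler i * euler j ^+ m j by rewrite -mulrA.
by apply: commr_sym; apply: commrX; exact: eulerC.
Qed.

Lemma ThetaX i f : Theta ('X_i * f) = euler i * Theta f.
Proof.
elim/mpolyind: f => [|c m f _ _ IH]; first by rewrite mulr0 Theta0 mulr0.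
rewrite mulrDr -scalerAr -mpolyXD !ThetaP IH mulrDr -scalerAr /Theta !mmapX.
by rewrite mmap1_euler.
Qed.

(** Reduces closure under arbitrary polynomial factors to closure under single
    Euler operators, so that the work below takes place in a commutative ring. *)
Lemma Theta_ideal (Q : D -> Prop) f g :
  (forall P1 P2, Q P1 -> Q P2 -> Q (P1 + P2)) -> (forall c P, Q P -> Q (c *: P)) ->
  (forall i P, Q P -> Q (euler i * P)) -> Q (Theta g) -> Q (Theta (f * g)).
Proof.
move=> QD QZ QE Qg; elim/mpolyind: f => [|c m f _ _ IH].
  by rewrite mul0r Theta0 -(scale0r (Theta g)); apply: QZ.
rewrite mulrDl -scalerAl ThetaP; apply: (QD) => //; apply: QZ.
rewrite mpolyXE_id; elim/big_rec: _ => [|i h _ IHh]; first by rewrite mul1r.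
elim: (m i) => [|k IHk]; first by rewrite mul1r.
by rewrite exprS -!mulrA ThetaX; apply: QE; rewrite mulrA.
Qed.

Lemma Theta_horner p :
  Theta (horner_alg ('X_ti : {mpoly K[n + 1]}) p) = horner_alg (opt K n * opdt K n) p.
Proof.
elim/poly_ind: p => [|p c IH]; first by rewrite !rmorph0 Theta0.
rewrite mulrC !rmorphD !rmorphM /= !horner_algX !horner_algC -IH -ThetaX.
rewrite addrC ThetaP addrC; congr (_ + _ *: _).
by rewrite -[1 : {mpoly _[_]}]/(1%:MP) [LHS]mmapC /= scale1r.
Qed.

(** The exponent of the normally ordered monomial [x^m d^m]. *)
Definition dbl m : 'X_{1..(n + 1) + (n + 1)} :=
  [multinom (match split i with inl j => m j | inr j => m j end) | i < (n + 1) + (n + 1)].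

Lemma dbl_l m i : dbl m (lshift (n + 1) i) = m i.
Proof. by rewrite mnmE (unsplitK (inl _ i)). Qed.
Lemma dbl_r m i : dbl m (rshift (n + 1) i) = m i.
Proof. by rewrite mnmE (unsplitK (inr _ i)). Qed.

Lemma mnm_ind (k : nat) (Q : 'X_{1..k} -> Prop) :
  Q 0%MM -> (forall i (e : 'X_{1..k}), Q e -> Q (U_(i) + e)%MM) -> forall e, Q e.
Proof.
move=> Q0 QS m; have [e] := ubnP (mdeg m); elim: e m => // e IH m.
rewrite ltnS => me; have [->//|nz] := eqVneq m 0%MM.
have [i mi] : exists i, (0 < m i)%N.
  apply/existsP; apply: contraNT nz; rewrite negb_exists => /forallP h.
  by apply/eqP/mnmP => i; rewrite mnm0E; have := h i; rewrite lt0n negbK => /eqP.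
have le : (U_(i) <= m)%MM by apply/mnm_lepP => j; rewrite mnm1E; case: eqP => [<-|].
rewrite -(submK le) addmC; apply: QS; apply: IH.
by apply: leq_trans me; rewrite -[in X in (_ < X)%N](submK le) mdegD mdeg1 addn1.
Qed.

(** Normal ordering of [theta_i x^m d^m] leaves the correction [m_i x^m d^m], so
    multiplication by [theta_i - m_i] raises the exponents of [x_i] and [d_i]. *)
Lemma Theta_ffp m : Theta (ffp K m) = Weyl 'X_[dbl m].
Proof.
elim/mnm_ind: m => [|i m IH].
  rewrite ffp0 (_ : dbl 0 = 0%MM) ?mpolyX0; last first.
    by apply/mnmP => i; rewrite mnmE !mnm0E; case: split => j; rewrite mnm0E.
  by rewrite -[1]/(1%:MP) [LHS]mmapC /= scale1r.
have /(canRL (addrK _)) -> := esym (ffp_mulX K i m).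
rewrite addrC -scaleNr ThetaP ThetaX IH; apply: symbolP.
rewrite [symbol (_ + _)](_ : _ = - (m i)%:R *: 'X_[dbl m]
   + symbol (euler i * Weyl 'X_[dbl m])) // symbol_euler /= mderivX dbl_l.
rewrite mulrDr -scalerAr -!mpolyXD.
have -> : (m i)%:R *: 'X_[U_(lshift (n + 1) i) + (dbl m - U_(lshift (n + 1) i))]
    = (m i)%:R *: 'X_[dbl m] :> {mpoly K[(n + 1) + (n + 1)]}.
  case E: (m i) => [|k]; first by rewrite !scale0r.
  congr (_ *: 'X_[_]); rewrite addmC submK //.
  by apply/mnm_lepP => j; rewrite mnm1E; case: eqP => [<-|//]; rewrite dbl_l E.
rewrite addrCA scaleNr addNr addr0; congr 'X_[_]; apply/mnmP => j.
case: (splitP j) => k ek.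
  have -> : j = lshift (n + 1) k by apply: val_inj.
  by rewrite !mnmDE !mnm1E !dbl_l eq_lshift eq_rlshift mnmDE mnm1E.
have -> : j = rshift (n + 1) k by apply: val_inj.
by rewrite !mnmDE !mnm1E !dbl_r eq_rshift eq_lrshift mnmDE mnm1E.
Qed.

Lemma Theta_ffp_mext a : Theta (ffp K (mext a 0)) = \prod_i opx K i ^+ a i * opd_mon K a.
Proof.
rewrite Theta_ffp (weyl_normal_form (Weyl _)) /= msuppX big_seq1 mcoeffX eqxx scale1r.
rewrite !big_split_ord !big_ord1 /=.
under eq_bigr do rewrite dbl_l mnmE (unsplitK (inl _ _)).
under [X in _ * (X * _)]eq_bigr do rewrite dbl_r mnmE (unsplitK (inl _ _)).
by rewrite dbl_l dbl_r mnmE (unsplitK (inr _ _)) !expr0 !mulr1.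
Qed.

End EulerOperators.

(** * Dickson's lemma *)

Section Dickson.

Lemma nat_monotone_subseq (f : nat -> nat) : exists phi : nat -> nat,
  (forall j k, (j < k)%N -> (phi j < phi k)%N) /\
  (forall j k, (j <= k)%N -> (f (phi j) <= f (phi k))%N).
Proof.
have min N : exists k, (N <= k)%N /\ forall j, (N <= j)%N -> (f k <= f j)%N.
  have exP : exists x, `[< exists2 k, (N <= k)%N & f k = x >].
    by exists (f N); apply/asboolP; exists N.
  case: (ex_minnP exP) => x /asboolP[k Nk <-] h; exists k; split=> // j Nj.
  by apply: h; apply/asboolP; exists j.
have [m mP] := choice min.
pose phi k := iter k (fun x => m x.+1) (m 0%N).
have lt1 k : (phi k < phi k.+1)%N by have [] := mP (phi k).+1.
have ltphi j k : (j < k)%N -> (phi j < phi k)%N.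
  by move: j k; apply: (@homo_ltn _ phi (fun x y => (x < y)%N)) => // x y z; exact: ltn_trans.
exists phi; split=> // j k; rewrite leq_eqVlt => /orP[/eqP->//|jk].
have {}jk := ltphi _ _ jk.
case: j jk => [|j] jk /=; first by have [_] := mP 0%N; apply.
have [_] := mP (phi j).+1; apply; apply: leq_trans (lt1 j) _; exact: ltnW.
Qed.

Variable n : nat.
Implicit Types (a b : 'X_{1..n}) (U : 'X_{1..n} -> Prop).

Lemma dickson (f : nat -> 'X_{1..n}) : exists phi : nat -> nat,
  (forall j k, (j < k)%N -> (phi j < phi k)%N) /\
  (forall j k, (j <= k)%N -> (f (phi j) <= f (phi k))%MM).
Proof.
suff [phi [h1 h2]] : exists phi : nat -> nat,
    (forall j k, (j < k)%N -> (phi j < phi k)%N) /\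
    (forall i, i \in enum 'I_n ->
       forall j k, (j <= k)%N -> (f (phi j) i <= f (phi k) i)%N).
  exists phi; split=> // j k jk; apply/mnm_lepP => i.
  by apply: h2 => //; rewrite mem_enum.
elim: (enum 'I_n) => [|i s [phi [h1 h2]]]; first by exists id.
have [psi [g1 g2]] := nat_monotone_subseq (fun k => f (phi k) i).
exists (phi \o psi); split=> [j k jk|i']; first by apply: h1; exact: g1.
rewrite in_cons => /predU1P[-> //|is_] j k jk; apply: h2 => //.
by move: jk; rewrite leq_eqVlt => /orP[/eqP->//|/g1/ltnW].
Qed.

Definition trunc B a : 'X_{1..n} := [multinom minn (a i) B | i < n].

(** Otherwise there are counterexamples for larger and larger caps. By Dickson's
    lemma they have an increasing subsequence, and the cap of a late term does not
    affect the part of it that lies above the first one. *)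
Lemma dickson_trunc U : (forall a b, (a <= b)%MM -> U a -> U b) ->
  exists B, forall a, U a -> U (trunc B a).
Proof.
move=> Uup; apply: contrapT => /forallNP h.
have h' B : exists a, U a /\ ~ U (trunc B a).
  by have /existsNP[a /not_implyP] := h B; exists a.
have [f fP] := choice h'; have [phi [p1 p2]] := dickson f.
have phik k : (k <= phi k)%N by elim: k => // k IH; apply: leq_ltn_trans (p1 k _ _).
(* Beyond the stage [k] the cap no longer affects the first term of the chain. *)
pose k := mdeg (f (phi 0%N)).
have [_ []] := fP (phi k); apply: Uup (fP (phi 0%N)).1; apply/mnm_lepP => i.
rewrite mnmE leq_min; apply/andP; split; first exact/mnm_lepP/p2.
by apply: leq_trans (phik k); rewrite /k mdegE (bigD1 i) //= leq_addr.
Qed.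

End Dickson.

(** * Faces of the optimal set and standard pairs *)

Section StandardPairs.
Variables (d n : nat) (A : 'M[int]_(d, n)) (w : 'rV[int]_n).
Implicit Types (a b c : 'X_{1..n}) (sigma : {set 'I_n}) (p : 'X_{1..n} * {set 'I_n}).

(** Conditions (i) and (ii) of a standard pair: [b + N^sigma] consists of optimal
    exponents. For separating weights condition (iii) is automatic in top
    dimension. *)
Definition face p := (forall i, i \in p.2 -> p.1 i = 0%N) /\
  forall c, (forall i, i \notin p.2 -> c i = 0%N) -> optimal A w (p.1 + c)%MM.

(** Capping exponents at the bound of [dickson_trunc], and letting the capped
    coordinates run freely, covers the optimal exponents by finitely many faces.
    The same bound applies to standard pairs: by (iii), a coordinate outside
    [sigma] that reached the bound could be raised without leaving the optimal
    set. *)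
Lemma face_cover : exists B,
  [/\ forall a, optimal A w a -> exists p,
        [/\ face p, forall i, (p.1 i <= B)%N &
            forall i, i \notin p.2 -> a i = p.1 i]
    & forall p, face p -> (forall l, l \notin p.2 -> exists c,
          (forall i, i \notin (l |: p.2)%SET -> c i = 0%N) /\ ~ optimal A w (p.1 + c)%MM) ->
        forall i, (p.1 i <= B)%N].
Proof.
have up a b : (a <= b)%MM -> ~ optimal A w a -> ~ optimal A w b.
  by move=> le na /(optimal_le le).
have [B BP] := dickson_trunc up.
exists B; split=> [a oa|[b sg] [b0 fb] std i /=].
  exists ([multinom if (a i < B)%N then a i else 0%N | i < n], [set i | (B <= a i)%N]%SET).
  split=> /=.
  - split=> [i /=|c c0 /=]; first by rewrite inE mnmE ltnNge => ->.
    apply: contrapT => /BP; apply; apply: optimal_le oa; apply/mnm_lepP => i.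
    rewrite mnmE mnmDE mnmE; have := c0 i; rewrite inE -ltnNge.
    by case: ltnP => [lt ->|le _]; rewrite ?addn0 ?geq_min ?leqnn ?le ?orbT.
  - by move=> i; rewrite mnmE; case: ltnP => // /ltnW.
  - by move=> i; rewrite inE -ltnNge mnmE => ->.
have [is_|nis] := boolP (i \in sg); first by rewrite b0.
have [c [c0 nopt]] := std i nis; rewrite leqNgt; apply/negP => Bb.
apply: (BP _ nopt).
apply: (optimal_le (b := (b + [multinom if j == i then 0 else c j | j < n])%MM)).
  apply/mnm_lepP => j; rewrite mnmE !mnmDE mnmE; case: eqP => [->|_].
    by rewrite addn0 geq_min (ltnW Bb) orbT.
  exact: geq_minl.
apply: fb => j js; rewrite mnmE; case: eqP => // /eqP ji.
by apply: c0; rewrite !inE negb_or ji.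
Qed.

Variable K : numFieldType.
Local Notation ti := (rshift n ord0 : 'I_(n + 1)).

Lemma standard_pairP p : standard_pair (monomial_in A w : set {mpoly K[n]}) p <->
  face p /\ forall l, l \notin p.2 -> exists c,
     (forall i, i \notin (l |: p.2)%SET -> c i = 0%N) /\ ~ optimal A w (p.1 + c)%MM.
Proof.
case: p => b sg; split=> [[h1 h2 h3]|[[h1 h2] h3]].
  split; first split=> // c c0.
    by apply: contrapT => no; apply: (h2 c c0); apply/monomial_inP.
  by move=> l /h3[c [c0 /monomial_inP]]; exists c.
split=> // [c c0 /monomial_inP|l /h3[c [c0 no]]]; first by apply; exact: h2.
by exists c; split=> //; apply/monomial_inP.
Qed.

(** Every exponent of a face is a root: the series based at [v] starts with
    [x^v t^(w.v)], on which [t d_t] acts by [w.v]. *)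
Lemma in_tau_HAw_root (beta : 'cV[K]_d) (v : 'cV[K]_n) p (q : {poly K}) :
  face p -> is_exponent A beta p v ->
  in_tau (HAw A w beta) (horner_alg (opt K n * opdt K n) q) -> q.[dotw w v] = 0.
Proof.
case: p => b sg [/= b0 fb] [/= vb Av] Jq.
pose v' i := v i 0; pose s := dotw w v.
have vE : \col_i v' i = v by apply/colP => i; rewrite mxE.
have pos u : in_region b sg u -> lattice_series K A w u != 0 -> 0 <= u ti 0.
  move=> ru /latticeP[Au wu].
  (* Large exponents on [sigma] make [b + c + u] nonnegative. *)
  pose c : 'X_{1..n} := [multinom if i \in sg then absz (u (lshift 1 i) 0)%R else 0%N | i < n].
  pose a' : 'X_{1..n} := [multinom absz (((b + c)%MM i)%:Z + u (lshift 1 i) 0)%R | i < n].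
  have ea : zcol a' = zcol (b + c) + usubmx u.
    apply/colP => i; rewrite !mxE mnmE gez0_abs // mnmDE PoszD [(c i)]mnmE.
    case: ifP => [_|/negbT nis]; last by rewrite addr0; exact: ru.
    rewrite -addrA addr_ge0 // abszE -lerBlDr sub0r; apply: le_trans (ler_norm _) _.
    by rewrite normrN.
  have oc : optimal A w (b + c)%MM by apply: fb => i nis; rewrite mnmE (negbTE nis).
  have := oc a'; rewrite ea mulmxDr Au addr0 => /(_ erefl).
  by rewrite /cost ea mulmxDr wu [X in _ <= X]mxE lerDl mxE.
have kills : forall l, HAw A w beta l ->
    series_act (xcoef v') (dcoef s) l (lattice_series K A w) =1 fun=> 0.
  by apply: HAw_kills; rewrite ?vE.
have := in_tau_kills (v := v') vb pos kills Jq (@in_region0 _ b sg).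
by rewrite act_ev leading_series0 mulr1 mxE addr0.
Qed.

End StandardPairs.

(** * Euler operators modulo the initial ideal *)

Section InitialIdealBound.
Variables (K : numFieldType) (d n : nat) (A : 'M[int]_(d, n)) (w : 'rV[int]_n).
Variable beta : 'cV[K]_d.
Local Notation D := (weyl K (n + 1)).
Local Notation ti := (rshift n ord0 : 'I_(n + 1)).
Local Notation xi j := (lshift 1 j : 'I_(n + 1)).
Local Notation AK := (map_mx intr A : 'M[K]_(d, n)).
Local Notation wK := (map_mx intr w : 'rV[K]_n).
Local Notation bcol b := (map_mx intr (zcol b) : 'cV[K]_n).
Local Notation H := (HAw A w beta).
Implicit Types (f g h : {mpoly K[n + 1]}) (b : 'X_{1..n}).

Definition lifts_poly f := lifts H (Theta f).

Lemma lifts_polyP c f g : lifts_poly f -> lifts_poly g -> lifts_poly (c *: f + g).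
Proof. by move=> lf lg; rewrite /lifts_poly ThetaP; exact: liftsD (liftsZ c lf) lg. Qed.

Lemma lifts_poly0 : lifts_poly 0.
Proof. by rewrite /lifts_poly Theta0; apply: lifts_ideal; exact: ideal0. Qed.

Lemma lifts_polyD f g : lifts_poly f -> lifts_poly g -> lifts_poly (f + g).
Proof. by move=> lf lg; rewrite -[f]scale1r; exact: lifts_polyP lf lg. Qed.

Lemma lifts_polyZ c f : lifts_poly f -> lifts_poly (c *: f).
Proof. by move=> lf; rewrite -[c *: f]addr0; exact: lifts_polyP lf lifts_poly0. Qed.

Lemma lifts_polyM f g : lifts_poly g -> lifts_poly (f * g).
Proof.
apply: Theta_ideal => [P1 P2|c P|i P lP]; [exact: liftsD|exact: liftsZ|].
case: (splitP i) => j ej.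
  have -> : i = xi j by apply: val_inj.
  by rewrite -mulrA; apply: lifts_opx; apply: lifts_opd.
have -> : i = ti by apply: val_inj; rewrite /= ej [j]ord1.
exact: lifts_theta_t.
Qed.

Lemma lifts_poly_sum (I : Type) (s : seq I) (F : I -> {mpoly K[n + 1]}) :
  (forall i, lifts_poly (F i)) -> lifts_poly (\sum_(i <- s) F i).
Proof.
by move=> h; elim/big_rec: _ => [|i f _]; [exact: lifts_poly0|exact: lifts_polyD].
Qed.

Lemma ThetaD f g : Theta (f + g) = Theta f + Theta g.
Proof. by have := ThetaP 1 f g; rewrite !scale1r. Qed.

Lemma ThetaZ c f : Theta (c *: f) = c *: Theta f.
Proof. by have := ThetaP c f 0; rewrite Theta0 !addr0. Qed.

Lemma ThetaB f g : Theta (f - g) = Theta f - Theta g.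
Proof. by rewrite -!scaleN1r ThetaD ThetaZ. Qed.

Lemma Theta_sum (I : Type) (s : seq I) (F : I -> {mpoly K[n + 1]}) :
  Theta (\sum_(i <- s) F i) = \sum_(i <- s) Theta (F i).
Proof. by elim/big_rec2: _ => [|i y f _ <-]; rewrite ?Theta0 ?ThetaD. Qed.

Lemma ThetaC (c : K) : Theta (c%:MP : {mpoly K[n + 1]}) = c%:A.
Proof. exact: mmapC. Qed.

Lemma ThetaU i : Theta ('X_i : {mpoly K[n + 1]}) = euler K i.
Proof. by rewrite -['X_i]mulr1 ThetaX -[1]/(1%:MP) ThetaC scale1r mulr1. Qed.

Lemma lifts_euler i : lifts_poly (\sum_j AK i j *: 'X_(xi j) - (beta i 0)%:MP).
Proof.
apply: lifts_ideal; apply: ideal_gen; left; left; exists i.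
rewrite ThetaB ThetaC Theta_sum; congr (_ - _).
by apply: eq_bigr => j _; rewrite ThetaZ ThetaU mxE.
Qed.

Lemma lifts_euler_t : lifts_poly (\sum_j wK 0 j *: 'X_(xi j) - 'X_ti).
Proof.
apply: lifts_ideal; apply: ideal_gen; left; right.
rewrite ThetaB ThetaU Theta_sum; congr (_ - _).
by apply: eq_bigr => j _; rewrite ThetaZ ThetaU mxE.
Qed.

Definition mrestr (m : 'X_{1..n + 1}) : 'X_{1..n} := [multinom m (xi i) | i < n].

Lemma lifts_ffp m : ~ optimal A w (mrestr m) -> lifts_poly (ffp K m).
Proof.
move=> no; have -> : ffp K m = (\prod_(j < m ti) ('X_ti - j%:R%:MP))
    * ffp K (mext (mrestr m) 0).
  rewrite mulrC /ffp !big_split_ord !big_ord1 /= [X in _ * X * _](_ : _ = 1).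
    rewrite mulr1; congr (_ * _); apply: eq_bigr => i _.
    by rewrite [mext _ _ _]mnmE (unsplitK (inl _ i)) mnmE.
  by rewrite mnmE (unsplitK (inr _ ord0)) big_ord0.
apply: lifts_polyM; rewrite /lifts_poly Theta_ffp_mext.
have [l Il lW] := @not_optimal_lifts d n A w K _ no.
have : lifts H (opd_mon K (mrestr m)).
  exists l => //; case: Il => s [sS ->]; exists s; split=> // c /sS cS.
  by right.
move=> {l Il lW} L; elim/big_rec: _ => [|i f _ IH]; first by rewrite mul1r.
elim: (mrestr m i) => [|k IHk]; first by rewrite mul1r.
by rewrite exprS -!mulrA; apply: lifts_opx; rewrite mulrA.
Qed.

(** The linear form [z w - y A] recentred at [b], in the Euler operators of [x].
    Modulo [A theta - beta] and [w theta - t d_t] it becomes the polynomial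
    [z s - face_const] in [s = t d_t]. *)
Definition face_form (z : K) (y : 'rV[K]_d) b : {mpoly K[n + 1]} :=
  \sum_j (z *: wK - y *m AK) 0 j *: ('X_(xi j) - (b j)%:R%:MP).

Definition face_const (z : K) (y : 'rV[K]_d) b : K :=
  (z *: (wK *m bcol b) + y *m (beta - AK *m bcol b)) 0 0.

Lemma face_coefE z (y : 'rV[K]_d) j :
  (z *: wK - y *m AK) 0 j = z * wK 0 j - (y *m AK) 0 j.
Proof. by rewrite [LHS]mxE [X in X + _]mxE [X in _ + X]mxE. Qed.

Lemma face_constE z (y : 'rV[K]_d) b : face_const z y b =
  z * (wK *m bcol b) 0 0 + ((y *m beta) 0 0 - (y *m (AK *m bcol b)) 0 0).
Proof.
by rewrite /face_const mulmxBr mxE [X in X + _]mxE; congr (_ + _); rewrite mxE; congr (_ + _); rewrite mxE.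
Qed.

Lemma face_form_lifts z y b :
  lifts_poly (face_form z y b - (z *: 'X_ti - (face_const z y b)%:MP)).
Proof.
pose E i : {mpoly K[n + 1]} := \sum_j AK i j *: 'X_(xi j) - (beta i 0)%:MP.
have -> : face_form z y b - (z *: 'X_ti - (face_const z y b)%:MP) =
    z *: (\sum_j wK 0 j *: 'X_(xi j) - 'X_ti) + - 1 *: \sum_i y 0 i *: E i.
  have e1 : face_form z y b = z *: \sum_j wK 0 j *: 'X_(xi j)
      - \sum_j (y *m AK) 0 j *: 'X_(xi j)
      - (z * (wK *m bcol b) 0 0 - (y *m (AK *m bcol b)) 0 0)%:MP.
    rewrite /face_form; under eq_bigr do rewrite scalerBr.
    rewrite sumrB; congr (_ - _).
      rewrite scaler_sumr -sumrB; apply: eq_bigr => j _.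
      by rewrite face_coefE scalerBl scalerA.
    have m1 : (wK *m bcol b) 0 0 = \sum_j wK 0 j * bcol b j 0 by rewrite mxE.
    have m2 : (y *m (AK *m bcol b)) 0 0 = \sum_j (y *m AK) 0 j * bcol b j 0.
      by rewrite mulmxA mxE.
    rewrite m1 m2 mulr_sumr -sumrB raddf_sum /=.
    apply: eq_bigr => j _; rewrite -mul_mpolyC -mpolyCM; congr (_%:MP).
    rewrite face_coefE [bcol b j 0]mxE [zcol b j 0]mxE.
    ring.
  have e2 : \sum_i y 0 i *: E i = \sum_j (y *m AK) 0 j *: 'X_(xi j)
       - ((y *m beta) 0 0)%:MP.
    rewrite /E; under eq_bigr do rewrite scalerBr scaler_sumr.
    rewrite sumrB; congr (_ - _).
      rewrite exchange_big; apply: eq_bigr => j _; rewrite [in RHS]mxE scaler_suml.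
      by apply: eq_bigr => i _; rewrite scalerA.
    rewrite mxE raddf_sum; apply: eq_bigr => i _.
    by rewrite -mul_mpolyC -mpolyCM.
  rewrite e1 e2 face_constE !(mpolyCD, mpolyCN) scalerBr scaleN1r; ring.
apply: lifts_polyP; first exact: lifts_euler_t.
by apply: lifts_polyZ; apply: lifts_poly_sum => i; apply: lifts_polyZ; exact: lifts_euler.
Qed.

Lemma face_form_vanish z y (p : 'X_{1..n} * {set 'I_n}) (m : 'X_{1..n + 1}) :
  (forall j, j \in p.2 -> z * wK 0 j = (y *m AK) 0 j) ->
  (forall j, j \notin p.2 -> m (xi j) = p.1 j) ->
  (face_form z y p.1).@[fun i => (m i)%:R] = 0.
Proof.
move=> h1 h2; rewrite /face_form raddf_sum /= big1 // => j _.
rewrite mevalZ mevalB mevalXU mevalC; have [js|js] := boolP (j \in p.2).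
  by rewrite face_coefE h1 // subrr mul0r.
by rewrite h2 // subrr mulr0.
Qed.

(** One linear form per face, vanishing on that face: their product vanishes at
    all optimal exponents, hence is a combination of falling factorials of
    monomials of the initial ideal. *)
Lemma face_product (ps : seq ('X_{1..n} * {set 'I_n})) (z : 'X_{1..n} * {set 'I_n} -> K)
    (y : 'X_{1..n} * {set 'I_n} -> 'rV[K]_d) (q : {poly K}) :
  (forall a, optimal A w a ->
     exists2 p, p \in ps & forall i, i \notin p.2 -> a i = p.1 i) ->
  (forall p, p \in ps -> forall j, j \in p.2 -> z p * wK 0 j = (y p *m AK) 0 j) ->
  in_tau H (horner_alg (opt K n * opdt K n)
    (q * \prod_(p <- ps) (z p *: 'X - (face_const (z p) (y p) p.1)%:P))).
Proof.
move=> cover zy; apply: lifts_in_tau.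
  set r := (X in horner_alg _ X); elim/poly_ind: r => [|r c IH].
    by rewrite rmorph0; exact: wt_in0.
  rewrite mulrC rmorphD rmorphM /= horner_algX horner_algC.
  apply: wt_inD; first exact: wt_in_theta_t.
  apply: wt_inZ; have := @opd_mon_wt n K 0%MM.
  by rewrite /opd_mon big1 // => i _; rewrite mnm0E expr0.
rewrite -Theta_horner rmorphM; apply: lifts_polyM.
have zero : lifts_poly (\prod_(p <- ps) face_form (z p) (y p) p.1).
  apply: (@ffp_vanishing K (n + 1) (fun m => ~ optimal A w (mrestr m))).
  - move=> a b le no; move/(optimal_le (a := mrestr a)); apply: contra_not no; apply.
    by apply/mnm_lepP => i; rewrite !mnmE; move/mnm_lepP: le.
  - exact: lifts_poly0.
  - exact: lifts_polyP.
  - exact: lifts_ffp.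
  move=> m /contrapT/cover[p pps e]; rewrite rmorph_prod /=.
  rewrite (big_rem p) //= face_form_vanish ?mul0r //; first exact: zy.
  by move=> j /e <-; rewrite mnmE.
have congr_ : lifts_poly (\prod_(p <- ps) face_form (z p) (y p) p.1 -
    \prod_(p <- ps) (z p *: 'X_ti - (face_const (z p) (y p) p.1)%:MP)).
  elim: ps {cover zy zero} => [|p ps IH].
    by rewrite !big_nil subrr; exact: lifts_poly0.
  rewrite !big_cons; set F := face_form _ _ p.1; set E := (_ - (face_const (z p) _ _)%:MP).
  set P1 := \prod_(j <- ps) face_form _ _ _ in IH *.
  set P2 := \prod_(j <- ps) _ in IH *.
  have -> : F * P1 - E * P2 = P1 * (F - E) + E * (P1 - P2) by ring.
  exact: lifts_polyD (lifts_polyM P1 (face_form_lifts _ _ _)) (lifts_polyM E IH).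
rewrite rmorph_prod /=.
have -> : \prod_(p <- ps) horner_alg ('X_ti : {mpoly K[n + 1]})
      (z p *: 'X - (face_const (z p) (y p) p.1)%:P) =
    \prod_(p <- ps) (z p *: 'X_ti - (face_const (z p) (y p) p.1)%:MP).
  apply: eq_bigr => p _; rewrite rmorphB /= horner_algC linearZ /= horner_algX.
  by congr (_ - _); rewrite -?scalerAl ?mul1r // -mul_mpolyC mulr1.
set P1 := \prod_(p <- ps) face_form _ _ _ in zero congr_.
set P2 := \prod_(p <- ps) _ in congr_ *.
have -> : P2 = P1 + -1 *: (P1 - P2) by rewrite scaleN1r opprB addrC subrK.
exact: lifts_polyD zero (lifts_polyZ _ congr_).
Qed.

End InitialIdealBound.

(** * Integer dependencies between the columns *)

Section Columns.
Variables (d n : nat) (A : 'M[int]_(d, n)).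
Implicit Types (sigma tau : {set 'I_n}) (h x : 'cV[int]_n).

Definition dependency sigma h :=
  [/\ h != 0, A *m h = 0 & forall i, i \notin sigma -> h i 0 = 0].

Definition dependent sigma := exists h, dependency sigma h.

Section Inclusion.
Variables (R : comNzRingType) (f : 'I_d -> 'I_n).
Hypothesis f_inj : injective f.

Definition incl_mx : 'M[R]_(n, d) := \matrix_(i, k) (f k == i)%:R.

Lemma mulmx_incl m (M : 'M[R]_(m, n)) i k : (M *m incl_mx) i k = M i (f k).
Proof.
rewrite mxE (bigD1 (f k)) //= mxE eqxx mulr1 big1 ?addr0 // => j jk.
by rewrite mxE eq_sym (negbTE jk) mulr0.
Qed.

Lemma incl_mulmx_out (x : 'cV[R]_d) i : (forall k, f k != i) -> (incl_mx *m x) i 0 = 0.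
Proof. by move=> fi; rewrite mxE big1 // => k _; rewrite mxE (negbTE (fi k)) mul0r. Qed.

Lemma incl_mulmx_in (x : 'cV[R]_d) k : (incl_mx *m x) (f k) 0 = x k 0.
Proof.
rewrite mxE (bigD1 k) //= mxE eqxx mul1r big1 ?addr0 // => j jk.
by rewrite mxE (inj_eq f_inj) (negbTE jk) mul0r.
Qed.

End Inclusion.

Lemma map_incl_mx (R : comNzRingType) f : map_mx intr (incl_mx int f) = incl_mx R f.
Proof. by apply/matrixP => i k; rewrite !mxE; case: eqP. Qed.

Lemma set_enum_fun sigma : #|sigma| = d -> exists2 f : 'I_d -> 'I_n,
  injective f & forall i, i \in sigma <-> exists k, f k = i.
Proof.
move=> e; pose f k := enum_val (cast_ord (esym e) k); exists f.
  by move=> j k /enum_val_inj/cast_ord_inj.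
move=> i; split=> [is_|[k <-]]; last exact: enum_valP.
exists (cast_ord e (enum_rank_in is_ i)).
by rewrite /f cast_ordK enum_rankK_in.
Qed.

Lemma det_neq0 sigma f : injective f ->
  (forall i, i \in sigma <-> exists k, f k = i) -> ~ dependent sigma ->
  \det (A *m incl_mx int f) != 0.
Proof.
move=> fi fs nd; rewrite -det_tr; apply/negP => /det0P[v v0 ev]; apply: nd.
exists (incl_mx int f *m v^T); split.
- apply: contra v0 => /eqP e; apply/eqP/rowP => k.
  by rewrite -[v]trmxK [LHS]mxE -(incl_mulmx_in fi) e !mxE.
- by rewrite mulmxA -[_ *m _]trmxK trmx_mul trmxK ev trmx0.
move=> i nis; apply: incl_mulmx_out => k; apply/eqP => e.
by case/negP: nis; apply/fs; exists k.
Qed.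

(** Cramer's rule: a vector can be prescribed off a basis, up to the determinant
    of the basis, and completed to an integer relation between the columns. *)
Lemma cramer_relation sigma : #|sigma| = d -> ~ dependent sigma ->
  exists2 D : int, D != 0 & forall x : 'cV[int]_n, exists2 h : 'cV[int]_n,
    A *m h = 0 & forall i, i \notin sigma -> h i 0 = D * x i 0.
Proof.
move=> e nd; have [f fi fs] := set_enum_fun e.
pose C := A *m incl_mx int f.
exists (\det C); first exact: (det_neq0 fi fs nd).
move=> x; exists (\det C *: x - incl_mx int f *m (\adj C *m (A *m x))).
  rewrite mulmxBr mulmxA -/C [C *m (_ *m _)]mulmxA mul_mx_adj mul_scalar_mx.
  by rewrite -scalemxAr subrr.
move=> i nis; rewrite mxE [X in _ + X]mxE incl_mulmx_out ?subr0 ?mxE // => k.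
by apply/eqP => ek; case/negP: nis; apply/fs; exists k.
Qed.

Lemma dependentS sigma tau : sigma \subset tau -> dependent sigma -> dependent tau.
Proof.
move=> /fintype.subsetP st [h [h0 Ah hs]]; exists h; split=> // i nit.
by apply: hs; apply: contra nit => /st.
Qed.

Lemma dependent_card sigma : (d < #|sigma|)%N -> dependent sigma.
Proof.
move=> lt; have /card_geqP[s [us zs sub]] := ltnW lt.
pose tau := [set x in s]%SET.
have ct : #|tau| = d by rewrite cardsE (card_uniqP us).
have st : tau \subset sigma by apply/fintype.subsetP => i; rewrite inE => /sub.
have [/(dependentS st)//|nd] := pselect (dependent tau).
have [l ls lt'] : exists2 l, l \in sigma & l \notin tau.
  have : (0 < #|sigma :\: tau|)%N by rewrite cardsDS // subn_gt0 ct.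
  by case/card_gt0P => l; rewrite inE => /andP[]; exists l.
have [D D0 /(_ (delta_mx l 0))[h Ah hD]] := cramer_relation ct nd.
exists h; split=> //.
  apply/eqP => /colP/(_ l); rewrite (hD l lt') !mxE !eqxx mulr1.
  by move/eqP; rewrite (negbTE D0).
move=> i nis; rewrite hD; last by apply: contra nis; exact: (fintype.subsetP st).
by rewrite !mxE; case: eqP nis => [->|]; rewrite ?ls //= mulr0.
Qed.

Variable K : numFieldType.
Local Notation AK := (map_mx intr A : 'M[K]_(d, n)).

Lemma basis_unit sigma f : injective f ->
  (forall i, i \in sigma <-> exists k, f k = i) -> ~ dependent sigma ->
  AK *m incl_mx K f \in unitmx.
Proof.
move=> fi fs nd; rewrite unitmxE unitfE -map_incl_mx -map_mxM.
by rewrite -[\det _]/(\det (map_mx (intr : {rmorphism int -> K}) _)) det_map_mx intr_eq0 (det_neq0 fi fs nd).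
Qed.

Lemma basis_dual sigma (r : 'rV[K]_n) : #|sigma| = d -> ~ dependent sigma ->
  exists y : 'rV[K]_d, forall j, j \in sigma -> r 0 j = (y *m AK) 0 j.
Proof.
move=> e nd; have [f fi fs] := set_enum_fun e.
have U := basis_unit fi fs nd.
exists (r *m incl_mx K f *m invmx (AK *m incl_mx K f)) => j /fs[k <-].
rewrite -[RHS]mulmx_incl -[LHS]mulmx_incl; congr (fun_of_matrix _ 0 k).
by rewrite -[RHS]mulmxA -[RHS]mulmxA mulVmx // mulmx1.
Qed.

Lemma basis_exponent sigma (b : 'X_{1..n}) (beta : 'cV[K]_d) :
  #|sigma| = d -> ~ dependent sigma ->
  exists v, forall u, is_exponent A beta (b, sigma) u <-> u = v.
Proof.
move=> e nd; have [f fi fs] := set_enum_fun e.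
have U := basis_unit fi fs nd.
have out i : i \notin sigma -> forall k, f k != i.
  by move=> nis k; apply/eqP => ek; case/negP: nis; apply/fs; exists k.
pose bK : 'cV[K]_n := \col_i (b i)%:R.
pose v := bK + incl_mx K f *m (invmx (AK *m incl_mx K f) *m (beta - AK *m bK)).
have vE : is_exponent A beta (b, sigma) v.
  split=> [i /= nis|]; first by rewrite mxE incl_mulmx_out ?addr0 ?mxE //; exact: out.
  by rewrite mulmxDr [AK *m (_ *m _)]mulmxA mulKVmx // subrKC.
exists v => u; split=> [[uo Au]|->//].
have [vo Av] := vE.
pose x : 'cV[K]_d := \col_k (u (f k) 0 - v (f k) 0).
have ux : u - v = incl_mx K f *m x.
  apply/colP => i; have [/fs[k <-]|nis] := boolP (i \in sigma).
    by rewrite incl_mulmx_in // !mxE.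
  rewrite incl_mulmx_out; last exact: out.
  by rewrite mxE [X in _ + X]mxE uo // vo // subrr.
have x0 : x = 0.
  apply: (can_inj (mulKmx U)); rewrite mulmx0 -mulmxA -ux mulmxBr.
  by rewrite [X in X - _]Au [X in _ - X]Av subrr.
by apply/eqP; rewrite -subr_eq0 ux x0 mulmx0.
Qed.

(** Fewer than [d] columns lie in a hyperplane [y = 0]; a face spanned by them only
    meets the parameters [beta] of a translate of it. *)
Lemma small_dual sigma : (#|sigma| < d)%N ->
  exists2 y : 'rV[K]_d, y != 0 & forall j, j \in sigma -> (y *m AK) 0 j = 0.
Proof.
move=> lt; pose B : 'M[K]_(d, #|sigma|) := \matrix_(i, k) AK i (enum_val k).
have : kermx B != 0.
  by rewrite -mxrank_eq0 mxrank_ker -lt0n subn_gt0 (leq_ltn_trans (rank_leq_col B)).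
case/rowV0Pn => y /sub_kermxP yB y0; exists y => // j js.
have /rowP/(_ (enum_rank_in js j)) := yB; rewrite !mxE => {2}<-.
by apply: eq_bigr => i _; rewrite !mxE enum_rankK_in.
Qed.

Lemma row_mul_eq0 (y : 'rV[K]_d) :
  (forall z : 'cV[int]_d, exists x : 'cV[int]_n, A *m x = z) -> y *m AK = 0 -> y = 0.
Proof.
move=> spanA yA; apply/rowP => i; have [x Ax] := spanA (delta_mx i 0).
have := congr1 (fun M => y *m map_mx intr M) Ax.
rewrite /= map_mxM mulmxA yA mul0mx => /matrixP/(_ 0 0).
rewrite mxE [in RHS]mxE (bigD1 i) //= !mxE !eqxx mulr1 big1 ?addr0 // => j ji.
by rewrite !mxE (negbTE ji) mulr0.
Qed.

End Columns.

(** * Affine forms and natural points *)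

Section NaturalPoints.
Variable K : numFieldType.

Lemma poly_natural_nonroot (p : {poly K}) : p != 0 -> exists k : nat, p.[k%:R] != 0.
Proof.
move=> p0; apply: contrapT => /forallNP h.
have := @max_poly_roots _ p [seq k%:R | k <- iota 0 (size p)] p0.
rewrite size_map size_iota ltnn => F; suff: false by [].
apply: F.
  by apply/allP => _ /mapP[k _ ->]; apply/rootP/eqP/negPn/negP; exact: h.
by rewrite map_inj_uniq ?iota_uniq // => i j /eqP; rewrite eqr_nat => /eqP.
Qed.

(** On the curve [(k, k^2, ..., k^n)] an affine form becomes a nonzero polynomial
    in [k]. *)
Lemma natural_nonvanishing n (forms : seq ('rV[K]_n * K)) :
  (forall e, e \in forms -> e.1 != 0 \/ e.2 != 0) ->
  exists a : 'X_{1..n}, forall e, e \in forms ->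
    (e.1 *m (\col_i (a i)%:R)) 0 0 + e.2 != 0.
Proof.
move=> nz; pose P (e : 'rV[K]_n * K) : {poly K} := \sum_i e.1 0 i *: 'X^(i.+1) + e.2%:P.
have Pk e k : (P e).[k%:R] = \sum_i e.1 0 i * (k ^ i.+1)%:R + e.2.
  rewrite hornerD hornerC horner_sum; congr (_ + _).
  by apply: eq_bigr => i _; rewrite hornerZ hornerXn natrX.
have P0 e : e \in forms -> P e != 0.
  move=> /nz e0; apply/eqP => Pe.
  have c2 : e.2 = 0.
    have := congr1 (fun p : {poly K} => p`_0) Pe.
    rewrite coefD coefC coef_sum big1 ?add0r ?coef0 // => i _.
    by rewrite coefZ coefXn mulr0.
  case: e0 => [|]; last by rewrite c2 eqxx.
  case/negP; apply/eqP/rowP => i; have := congr1 (fun p : {poly K} => p`_i.+1) Pe.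
  rewrite coefD coefC addr0 coef_sum coef0 (bigD1 i) //= coefZ coefXn eqxx mulr1.
  rewrite big1 ?addr0 => [->|j ji]; first by rewrite mxE.
  by rewrite coefZ coefXn eqSS eq_sym (inj_eq val_inj) (negbTE ji) mulr0.
have [k kP] : exists k : nat, (\prod_(e <- forms) P e).[k%:R] != 0.
  by apply: poly_natural_nonroot; rewrite prodf_seq_neq0; apply/allP => e /P0.
exists [multinom (k ^ i.+1)%N | i < n] => e ef.
have -> : (e.1 *m (\col_i ([multinom (k ^ j.+1)%N | j < n] i)%:R)) 0 0 + e.2 = (P e).[k%:R].
  by rewrite Pk mxE; congr (_ + _); apply: eq_bigr => i _; rewrite mxE mnmE.
move: kP; rewrite horner_prod prodf_seq_neq0 => /allP/(_ e ef); exact.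
Qed.

End NaturalPoints.

(** * Generic weights *)

Section GenericWeights.
Variables (d n : nat) (A : 'M[int]_(d, n)).
Implicit Types (w : 'rV[int]_n) (h : 'cV[int]_n) (sigma : {set 'I_n})
  (b c : 'X_{1..n}) (p : 'X_{1..n} * {set 'I_n}).

Definition pos_part h : 'X_{1..n} :=
  [multinom if (0 <= h i 0)%R then absz (h i 0)%R else 0%N | i < n].

Lemma pos_partB h : zcol (pos_part h) = h + zcol (pos_part (- h)).
Proof.
apply/colP => i; rewrite !mxE !mnmE !mxE.
case: (leP 0 (h i 0)) => [le|lt].
  rewrite gez0_abs // oppr_ge0; case: leP => [le0|_]; last by rewrite addr0.
  by rewrite (@le_anti _ _ (h i 0) 0) ?le0.
by rewrite oppr_ge0 ltW // abszN lez0_abs ?subrr // ltW.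
Qed.

Lemma pos_part_eq0 h i : h i 0 <= 0 -> pos_part h i = 0%N.
Proof.
by move=> le; rewrite mnmE; case: leP => // ge; rewrite (@le_anti _ _ (h i 0) 0) ?le.
Qed.

Lemma zcol_pos_part h b : A *m h = 0 ->
  A *m zcol (b + pos_part h) = A *m zcol (b + pos_part (- h)).
Proof. by move=> Ah; rewrite !zcolD pos_partB !mulmxDr Ah add0r. Qed.

Lemma cost_pos_part w h b :
  cost w (b + pos_part h) = cost w (b + pos_part (- h)) + (w *m h) 0 0.
Proof.
rewrite !costD -addrA; congr (_ + _).
by rewrite /cost pos_partB mulmxDr mxE addrC.
Qed.

(** Moving along a relation supported in [sigma], in either direction, stays in the
    face, hence among optimal exponents. *)
Lemma face_independent w p h : face A w p -> dependency A p.2 h ->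
  (w *m h) 0 0 = 0.
Proof.
move=> [b0 fb] [h0 Ah hs].
have opt (g : 'cV[int]_n) : (forall i, i \notin p.2 -> g i 0 = 0) -> optimal A w (p.1 + pos_part g).
  by move=> gs; apply: fb => i /gs gi; rewrite pos_part_eq0 ?gi.
have o1 := opt h hs; have o2 : optimal A w (p.1 + pos_part (- h)).
  by apply: opt => i /hs; rewrite mxE => ->; rewrite oppr0.
have := o1 _ (esym (zcol_pos_part p.1 Ah)); have := o2 _ (zcol_pos_part p.1 Ah).
rewrite (cost_pos_part w h) lerDl gerDl => ge le.
by apply/eqP; rewrite eq_le le ge.
Qed.

(** A relation using one column [l] outside the face: moving along it leaves the
    face in the costly direction, which makes [(b, sigma)] standard and bounds [b]. *)
Lemma face_relation w p h l : face A w p -> A *m h = 0 ->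
  (forall i, i \notin (l |: p.2)%SET -> h i 0 = 0) -> 0 < h l 0 -> l \notin p.2 ->
  (w *m h) 0 0 != 0 ->
  ~ optimal A w (p.1 + pos_part h)%MM /\ (p.1 l < absz (h l 0)%R)%N.
Proof.
move=> [b0 fb] Ah hs hl nl wh0.
have hs' i : i != l -> i \notin p.2 -> h i 0 = 0.
  by move=> il nis; apply: hs; rewrite !inE negb_or il.
have cm i : i \notin p.2 -> pos_part (- h) i = 0%N.
  move=> nis; apply: pos_part_eq0; rewrite mxE oppr_le0.
  by have [->|il] := eqVneq i l; [exact: ltW|rewrite hs'].
have wh : 0 < (w *m h) 0 0.
  rewrite lt0r wh0 /=; have := fb _ cm _ (zcol_pos_part p.1 Ah).
  by rewrite (cost_pos_part w h) lerDl.
have nopt e : ~ optimal A w (e + pos_part h)%MM.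
  move=> /(_ _ (esym (zcol_pos_part e Ah))).
  by rewrite (cost_pos_part w h) gerDl leNgt wh.
split=> //; rewrite ltnNge; apply/negP => le.
pose k := absz (h l 0).
have lk : (U_(l) *+ k <= p.1)%MM.
  apply/mnm_lepP => i; rewrite mulmnE mnm1E.
  by case: eqP => [<-|_]; rewrite ?mul1n ?mul0n.
have lc : (U_(l) *+ k <= pos_part h)%MM.
  apply/mnm_lepP => i; rewrite mulmnE mnm1E.
  by case: eqP => [<-|_]; rewrite ?mul1n ?mul0n // mnmE ltW.
apply: (nopt (p.1 - U_(l) *+ k)%MM).
have -> : (p.1 - U_(l) *+ k + pos_part h = p.1 + (pos_part h - U_(l) *+ k))%MM.
  apply/mnmP => i; move/mnm_lepP/(_ i): lk; move/mnm_lepP/(_ i): lc.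
  rewrite !mnmDE !mnmBE; lia.
apply: fb => i nis; rewrite mnmBE mulmnE mnm1E.
have [<-|li] := eqVneq l i; first by rewrite mul1n mnmE ltW // subnn.
by rewrite mul0n subn0 pos_part_eq0 ?hs' // eq_sym.
Qed.

(** The two consequences of genericity that the proof uses: relations between
    columns have nonzero weight, and so have the relations comparing two faces
    with the same [sigma]. *)
Definition separating w :=
  (forall sigma, dependent A sigma ->
     exists2 h, dependency A sigma h & (w *m h) 0 0 != 0) /\
  (forall sigma b b', #|sigma| = d -> face A w (b, sigma) -> face A w (b', sigma) ->
     b != b' -> exists (h : 'cV[int]_n) (D : int), [/\ D != 0, A *m h = 0, (w *m h) 0 0 != 0 &
       forall i, i \notin sigma -> h i 0 = D * ((b i)%:Z - (b' i)%:Z)]).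

Lemma independent_face w p : separating w -> face A w p -> ~ dependent A p.2.
Proof.
move=> [sep _] fp /sep[h dh]; by rewrite (face_independent fp dh) eqxx.
Qed.

Lemma relation_pos w p l h : face A w p -> ~ dependent A p.2 -> l \notin p.2 ->
  dependency A (l |: p.2)%SET h -> (w *m h) 0 0 != 0 ->
  exists g : 'cV[int]_n, [/\ forall i, absz (g i 0) = absz (h i 0), A *m g = 0,
     (forall i, i \notin (l |: p.2)%SET -> g i 0 = 0), 0 < g l 0 & (w *m g) 0 0 != 0].
Proof.
move=> fp nd nl [h0 Ah hs] wh.
have hl : h l 0 != 0.
  apply: contra_not_neq nd => hl0; exists h; split=> // i nis.
  by have [->//|il] := eqVneq i l; apply: hs; rewrite !inE negb_or il.
have [lt|lt] := ltP 0 (h l 0); first by exists h.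
exists (- h); split=> [i||i /hs||]; rewrite ?mulmxN ?Ah ?oppr0 //.
- by rewrite mxE abszN.
- by rewrite mxE => ->; rewrite oppr0.
- by rewrite mxE oppr_gt0 lt_neqAle hl.
- by rewrite mxE oppr_eq0.
Qed.

Lemma top_face_standard w p : separating w -> face A w p -> #|p.2| = d ->
  forall l, l \notin p.2 -> exists c,
     (forall i, i \notin (l |: p.2)%SET -> c i = 0%N) /\ ~ optimal A w (p.1 + c)%MM.
Proof.
move=> sep fp cd l nl.
have /sep.1[h dh wh] : dependent A (l |: p.2)%SET.
  by apply: dependent_card; rewrite cardsU1 nl cd.
have [g [_ Ag gs gl wg]] := relation_pos fp (independent_face sep fp) nl dh wh.
exists (pos_part g); split; first by move=> i /gs gi; rewrite pos_part_eq0 ?gi.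
by have [] := face_relation fp Ag gs gl nl wg.
Qed.

(** Finitely many hyperplanes suffice for all weights at once, since the
    exponents [b] of top-dimensional faces are bounded independently of [w]. *)
Lemma generic_separating : generic_weight separating.
Proof.
have circ_ex (sigma : {set 'I_n}) : exists h, dependent A sigma -> dependency A sigma h.
  have [[h dh]|nd] := pselect (dependent A sigma); first by exists h.
  by exists 0.
have [circ circP] := choice circ_ex.
pose B := (\sum_(sigma : {set 'I_n}) \sum_i absz (circ sigma i 0)%R)%N.
pose T : finType := ({set 'I_n} * {ffun 'I_n -> 'I_B.+1} * {ffun 'I_n -> 'I_B.+1})%type.
pose relation (t : T) (h : 'cV[int]_n) := A *m h = 0 /\
  exists2 D : int, D != 0 & forall i, i \notin t.1.1 ->
    h i 0 = D * ((t.1.2 i : nat)%:Z - (t.2 i : nat)%:Z).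
have rel_ex (t : T) : exists h, #|t.1.1| = d -> ~ dependent A t.1.1 -> relation t h.
  have [[cd nd]|no] := pselect (#|t.1.1| = d /\ ~ dependent A t.1.1).
    have [D D0 /(_ (\col_i ((t.1.2 i : nat)%:Z - (t.2 i : nat)%:Z)))[h Ah hD]]
      := cramer_relation cd nd.
    by exists h => _ _; split=> //; exists D => // i /hD ->; rewrite mxE.
  by exists 0 => cd nd; case: no.
have [rel relP] := choice rel_ex.
exists [seq h <- [seq (circ sigma)^T | sigma : {set 'I_n}] ++
          [seq (rel t)^T | t : T] | h != 0].
  by rewrite mem_filter eqxx.
move=> w hw.
have wE h : h != 0 -> h^T \in [seq (circ sigma)^T | sigma : {set 'I_n}] ++
          [seq (rel t)^T | t : T] -> (w *m h) 0 0 != 0.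
  move=> h0 hin; have := hw h^T; rewrite mem_filter hin trmx_eq0 h0 => /(_ isT).
  by rewrite mxE; under eq_bigr do rewrite mxE mulrC.
have sep1 sigma : dependent A sigma ->
    exists2 h, dependency A sigma h & (w *m h) 0 0 != 0.
  move=> /circP dh; exists (circ sigma) => //; have [h0 _ _] := dh.
  by apply: wE => //; rewrite mem_cat fintype.image_f.
split=> // sigma b b' cd fb fb' bb'.
have nd : ~ dependent A sigma.
  by move=> /sep1[h dh]; rewrite (face_independent fb dh) eqxx.
have bound p : face A w p -> p.2 = sigma -> forall i, (p.1 i <= B)%N.
  move=> fp es i; have [is_|nis] := boolP (i \in p.2); first by rewrite fp.1.
  have dep : dependent A (i |: p.2)%SET.
    by apply: dependent_card; rewrite cardsU1 nis es cd.
  have dh := circP _ dep; have [h0 _ _] := dh.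
  have wh : (w *m circ (i |: p.2)%SET) 0 0 != 0.
    by apply: wE => //; rewrite mem_cat fintype.image_f.
  have ndp : ~ dependent A p.2 by rewrite es.
  have [g [ga Ag gs gl wg]] := relation_pos fp ndp nis dh wh.
  have [_ /ltnW le] := face_relation fp Ag gs gl nis wg.
  apply: leq_trans le _; rewrite ga /B (bigD1 (i |: p.2)%SET) //= (bigD1 i) //= -addnA.
  exact: leq_addr.
pose F (e : 'X_{1..n}) : {ffun 'I_n -> 'I_B.+1} := [ffun i => inord (e i)].
have FE p : face A w p -> p.2 = sigma -> forall i, F p.1 i = p.1 i :> nat.
  by move=> fp es i; rewrite ffunE inordK // ltnS; exact: bound.
have [Ah [D D0 hD]] := relP (sigma, F b, F b') cd nd.
have {}hD i : i \notin sigma -> rel (sigma, F b, F b') i 0 = D * ((b i)%:Z - (b' i)%:Z).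
  by move=> /hD ->; rewrite /= (FE _ fb) // (FE _ fb').
exists (rel (sigma, F b, F b')), D; split=> //.
apply: wE; last by rewrite mem_cat [X in _ || X]fintype.image_f ?orbT.
have [i bi] : exists i, b i != b' i.
  apply/existsP; apply: contraNT bb'; rewrite negb_exists => /forallP e.
  by apply/eqP/mnmP => i; apply/eqP; rewrite -[_ == _]negbK e.
have nis : i \notin sigma.
  by apply: contra bi => is_; rewrite (fb.1 i is_) (fb'.1 i is_).
apply/eqP => /colP/(_ i); rewrite hD // mxE => /eqP.
by rewrite mulf_eq0 (negbTE D0) subr_eq0 eqz_nat (negbTE bi).
Qed.

End GenericWeights.

(** * The indicial polynomial *)

Section IndicialPolynomial.
Variables (K : numFieldType) (d n : nat) (A : 'M[int]_(d, n)) (w : 'rV[int]_n).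
Local Notation AK := (map_mx intr A : 'M[K]_(d, n)).
Local Notation wK := (map_mx intr w : 'rV[K]_n).
Local Notation bcol b := (map_mx intr (zcol b) : 'cV[K]_n).
Implicit Types (p : 'X_{1..n} * {set 'I_n}) (beta : 'cV[K]_d) (y : 'rV[K]_d).

Definition mk_pair B (g : {ffun 'I_n -> 'I_B.+1}) (s : {set 'I_n}) :
  'X_{1..n} * {set 'I_n} := ([multinom (g i : nat) | i < n], s).

Definition bounded_faces B : seq ('X_{1..n} * {set 'I_n}) :=
  [seq p <- undup [seq mk_pair g s | g <- enum {: {ffun 'I_n -> 'I_B.+1}},
                                     s <- enum {: {set 'I_n}}] | `[< face A w p >]].

Lemma bounded_facesP B p :
  p \in bounded_faces B <-> face A w p /\ forall i, (p.1 i <= B)%N.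
Proof.
rewrite mem_filter mem_undup; split=> [/andP[/asboolP fp /allpairsP[[g s] [_ _ e]]]|[fp bp]].
  by split=> // i; rewrite e mnmE -ltnS.
apply/andP; split; first exact/asboolP.
apply/allpairsP; exists ([ffun i => inord (p.1 i)], p.2); rewrite !mem_enum; split=> //=.
rewrite /mk_pair [LHS]surjective_pairing; congr (_, _); apply/mnmP => i.
by rewrite mnmE ffunE inordK // ltnS.
Qed.

Lemma row_supported_mul (r : 'rV[K]_n) (s : {set 'I_n}) (x x' : 'cV[K]_n) :
  (forall j, j \in s -> r 0 j = 0) -> (forall j, j \notin s -> x j 0 = x' j 0) ->
  (r *m x) 0 0 = (r *m x') 0 0.
Proof.
move=> rs xx; rewrite !mxE; apply: eq_bigr => j _.
by have [/rs ->|/xx ->] := boolP (j \in s); rewrite ?mul0r.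
Qed.

Lemma entryB m k (X Y : 'M[K]_(m, k)) i j : (X - Y) i j = X i j - Y i j.
Proof. by rewrite !mxE. Qed.

(** In the sense of linear programming, for the dual vector [y]. *)
Definition reduced_cost y : 'rV[K]_n := wK - y *m AK.

Lemma face_const1E beta y b :
  face_const A w beta 1 y b = (y *m beta) 0 0 + (reduced_cost y *m bcol b) 0 0.
Proof.
rewrite face_constE mul1r /reduced_cost mulmxBl mulmxA.
by rewrite entryB addrCA.
Qed.

Lemma face_const0E beta y b :
  face_const A w beta 0 y b = (y *m beta) 0 0 - (y *m AK *m bcol b) 0 0.
Proof. by rewrite face_constE mul0r add0r mulmxA. Qed.

Lemma dotwE (v : 'cV[K]_n) : dotw w v = (wK *m v) 0 0.
Proof. by rewrite mxE; apply: eq_bigr => i _; rewrite mxE. Qed.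

(** The reduced cost vanishes on [sigma], and off [sigma] the exponent equals [b]. *)
Lemma dotw_exponent beta y p (v : 'cV[K]_n) :
  (forall j, j \in p.2 -> wK 0 j = (y *m AK) 0 j) -> is_exponent A beta p v ->
  dotw w v = face_const A w beta 1 y p.1.
Proof.
case: p => b s /= yw [/= vb Av]; rewrite dotwE face_const1E.
rewrite -(@row_supported_mul _ s v); last first.
- by move=> j /vb ->; rewrite !mxE.
- by move=> j js; rewrite entryB yw // subrr.
by rewrite /reduced_cost mulmxBl -Av mulmxA entryB subrKC.
Qed.

Definition affine_poly (e : 'rV[K]_d * K) : {mpoly K[d]} :=
  \sum_i e.1 0 i *: 'X_i + e.2%:MP.

Lemma affine_polyE e beta :
  (affine_poly e).@[fun i => beta i 0] = (e.1 *m beta) 0 0 + e.2.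
Proof.
rewrite /affine_poly mevalD mevalC raddf_sum mxE; congr (_ + _).
by apply: eq_bigr => i _; rewrite /= mevalZ mevalXU.
Qed.

(** A condition that holds off finitely many hyperplanes of the parameter space
    is generic: the columns of [A] span, so natural combinations of them already
    escape all these hyperplanes. *)
Lemma generic_param_forms (P : 'cV[K]_d -> Prop) (forms : seq ('rV[K]_d * K)) :
  (forall z : 'cV[int]_d, exists x : 'cV[int]_n, A *m x = z) ->
  (forall e, e \in forms -> e.1 != 0 \/ e.2 != 0) ->
  (forall beta, (forall e, e \in forms -> (e.1 *m beta) 0 0 + e.2 != 0) -> P beta) ->
  generic_param P.
Proof.
move=> spanA nz HP; pose f := \prod_(e <- forms) affine_poly e.
have fE beta : f.@[fun i => beta i 0] = \prod_(e <- forms) ((e.1 *m beta) 0 0 + e.2).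
  by rewrite rmorph_prod; apply: eq_bigr => e _; exact: affine_polyE.
exists [set beta | f.@[fun i => beta i 0] = 0]%classic; split.
- exists [set f]%classic; apply/seteqP; split=> [beta fb _ -> //|beta]; exact.
- pose forms' := [seq (e.1 *m AK, e.2) | e <- forms].
  have nz' e : e \in forms' -> e.1 != 0 \/ e.2 != 0.
    case/mapP => e' /nz[e1|e2] -> /=; [left|by right].
    by apply: contra e1 => /eqP /(row_mul_eq0 spanA) ->.
  have [a aP] := natural_nonvanishing nz'.
  move=> /seteqP[_ /(_ (AK *m \col_i (a i)%:R) I)] /=; rewrite fE => /eqP.
  apply/negP; rewrite prodf_seq_neq0; apply/allP => e ef /=.
  by rewrite mulmxA; apply: (aP (e.1 *m AK, e.2)); apply/mapP; exists e.
- move=> beta /eqP; rewrite /= fE prodf_seq_neq0 => /allP h.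
  by apply: HP => e ef; apply: h.
Qed.

Hypothesis spanA : forall z : 'cV[int]_d, exists x : 'cV[int]_n, A *m x = z.
Hypothesis sep : separating A w.

(** A functional [y] for which a form [z w - y A] vanishes on the columns of [s],
    with [z = 1] for a basis and [z = 0] for a smaller set. *)
Definition adapted_dual (s : {set 'I_n}) y :=
  (#|s| = d -> forall j, j \in s -> wK 0 j = (y *m AK) 0 j) /\
  ((#|s| < d)%N -> y != 0 /\ forall j, j \in s -> (y *m AK) 0 j = 0).

Lemma adapted_dual_exists s : exists y, ~ dependent A s -> adapted_dual s y.
Proof.
have [dep|nd] := pselect (dependent A s); first by exists 0.
have [e|ne] := eqVneq #|s| d.
  have [y yP] := basis_dual wK e nd; exists y => _; split=> //.
  by rewrite e ltnn.
have [lt|ge] := ltnP #|s| d; last first.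
  by case: nd; apply: dependent_card; rewrite ltn_neqAle eq_sym ne.
have [y y0 yP] := small_dual A K lt; exists y => _; split=> // e.
by rewrite e eqxx in ne.
Qed.

(** Distinct top-dimensional faces have distinct exponents for generic
    parameters: if the linear parts of the two affine functions of [beta] agree,
    then so do the two bases, and the constants differ by the weight of a relation. *)
Lemma top_face_forms_differ (y : {set 'I_n} -> 'rV[K]_d) p p' :
  (forall s, ~ dependent A s -> adapted_dual s (y s)) ->
  face A w p -> face A w p' -> #|p.2| = d -> #|p'.2| = d -> p != p' ->
  y p.2 - y p'.2 != 0 \/
  (reduced_cost (y p.2) *m bcol p.1) 0 0 - (reduced_cost (y p'.2) *m bcol p'.1) 0 0 != 0.
Proof.
move=> yP fp fp' cp cp' pp'.
have [yy|] := eqVneq (y p.2 - y p'.2) 0; last by left.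
right; have {}yy : y p'.2 = y p.2 by apply/esym/eqP; rewrite -subr_eq0 yy.
set r := reduced_cost (y p.2).
have wh (h : 'cV[int]_n) : A *m h = 0 ->
    ((w *m h) 0 0)%:~R = (r *m (map_mx intr h : 'cV[K]_n)) 0 0.
  move=> Ah; rewrite /r /reduced_cost mulmxBl -mulmxA -!map_mxM Ah map_mx0 mulmx0 subr0.
  by rewrite [RHS]mxE.
have r0 s : ~ dependent A s -> #|s| = d -> y s = y p.2 -> forall j, j \in s -> r 0 j = 0.
  move=> nd cs e j js; rewrite /r -e entryB.
  by rewrite (yP _ nd).1 // subrr.
have rp := r0 _ (independent_face sep fp) cp erefl.
have rp' := r0 _ (independent_face sep fp') cp' yy.
have [ss|ss] := eqVneq p.2 p'.2.
  have bb : p.1 != p'.1.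
    by apply: contra pp' => /eqP e; rewrite [p]surjective_pairing [p']surjective_pairing e ss.
  have fp2 : face A w (p.1, p.2) by rewrite -surjective_pairing.
  have fp2' : face A w (p'.1, p.2) by rewrite ss -surjective_pairing.
  have [h [D [D0 Ah whn hD]]] := sep.2 _ _ _ cp fp2 fp2' bb.
  rewrite yy -/r; apply: contra whn => /eqP e.
  rewrite -(intr_eq0 K) wh // (@row_supported_mul r p.2 _ (D%:~R *: (bcol p.1 - bcol p'.1))) //.
    by rewrite -scalemxAr mulmxBr mxE entryB e mulr0.
  by move=> j /hD hj; rewrite !mxE hj intrM intrB.
have [l lp' lp] : exists2 l, l \in p'.2 & l \notin p.2.
  have : ~~ (p'.2 \subset p.2).
    by apply: contra ss => sub; rewrite eq_sym eqEcard sub cp cp' leqnn.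
  by case/subsetPn => l; exists l.
have /sep.1[h [_ Ah hs] whn] : dependent A (l |: p.2)%SET.
  by apply: dependent_card; rewrite cardsU1 lp cp.
case/negP: whn; rewrite -(intr_eq0 K) wh // mxE big1 // => j _.
have [jl|] := boolP (j \in l |: p.2)%SET; last by move=> /hs; rewrite !mxE => ->; rewrite mulr0.
have -> : r 0 j = 0.
  by move: jl; rewrite !inE => /predU1P[->|/rp //]; exact: rp'.
by rewrite mul0r.
Qed.

Lemma generic_indicial : generic_param (fun beta : 'cV[K]_d =>
    let M : set {mpoly K[n]} := monomial_in A w in
    exists (T : seq ('X_{1..n} * {set 'I_n}))
           (v : 'X_{1..n} * {set 'I_n} -> 'cV[K]_n),
      [/\ uniq T,
          forall p, p \in T <-> top_standard_pair d M p,
          forall p, p \in T -> forall u, is_exponent A beta p u <-> u = v p,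
          T <> [::] -> is_indicial (HAw A w beta)
                         (\prod_(p <- T) ('X - (dotw w (v p))%:P)) &
          T = [::] -> is_indicial (HAw A w beta) 0]).
Proof.
have [B [cover bound]] := face_cover A w.
pose ps := bounded_faces B; pose T := [seq p : 'X_{1..n} * {set 'I_n} <- ps | #|p.2| == d].
have psP := bounded_facesP B.
have card_le p : face A w p -> (#|p.2| <= d)%N.
  move=> fp; rewrite leqNgt; apply/negP => /(dependent_card A).
  exact: independent_face sep fp.
have TP p : p \in T <-> top_standard_pair d (monomial_in A w : set {mpoly K[n]}) p.
  rewrite mem_filter; split=> [/andP[/eqP cp /psP[fp _]]|[/standard_pairP[fp std] cp]].
    by split=> //; apply/standard_pairP; split=> //; exact: top_face_standard sep fp cp.
  by rewrite cp eqxx; apply/psP; split=> //; exact: bound.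
have Tface p : p \in T -> face A w p /\ #|p.2| = d.
  by rewrite mem_filter => /andP[/eqP cp /psP[]].
have [y yP] := choice adapted_dual_exists.
(* The forms say that faces of lower dimension contribute nonzero constants, and
   that distinct top-dimensional faces have distinct roots. *)
pose small := [seq p : 'X_{1..n} * {set 'I_n} <- ps | (#|p.2| < d)%N].
pose pairs := [seq e <- [seq (p, p') | p <- T, p' <- T] | e.1 != e.2].
pose cst p := (reduced_cost (y p.2) *m bcol p.1) 0 0.
pose forms := [seq (y p.2, - (y p.2 *m AK *m bcol p.1) 0 0) | p <- small]
  ++ [seq (y e.1.2 - y e.2.2, cst e.1 - cst e.2) | e <- pairs].
apply: (@generic_param_forms _ forms) => // [e|beta gen].
  rewrite mem_cat => /orP[/mapP[p]|/mapP[[p p']]].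
    rewrite mem_filter => /andP[lt /psP[fp _]] ->; left.
    by have [_ /(_ lt)[]] := yP _ (independent_face sep fp).
  rewrite mem_filter => /andP[/= ne /allpairsP[[q q'] /= [qT qT' [ep ep']]]] ->.
  rewrite {}ep {}ep' /= in ne *.
  have [[fq cq] [fq' cq']] := (Tface _ qT, Tface _ qT').
  exact: top_face_forms_differ yP fq fq' cq cq' ne.
have v_ex p : exists v, p \in T -> forall u, is_exponent A beta p u <-> u = v.
  have [pT|nT] := boolP (p \in T); last by exists 0.
  have [fp cp] := Tface _ pT.
  have [v vP] := basis_exponent p.1 beta cp (independent_face sep fp).
  by exists v => _; rewrite [p]surjective_pairing.
have [v vP] := choice v_ex.
have vexp p : p \in T -> is_exponent A beta p (v p) by move=> /vP h; apply/h.
pose fc z p := face_const A w beta z (y p.2) p.1.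
have rootE p : p \in T -> dotw w (v p) = fc 1 p.
  move=> pT; have [fp cp] := Tface _ pT; apply: dotw_exponent (vexp _ pT).
  exact: (yP _ (independent_face sep fp)).1.
(* The contribution of the faces of lower dimension. *)
pose kappa := \prod_(p <- ps | #|p.2| != d) - fc 0 p.
have kappa0 : kappa != 0.
  rewrite prodf_seq_neq0; apply/allP => p pps; apply/implyP => ne.
  have [fp _] := (psP p).1 pps; rewrite oppr_eq0 /fc face_const0E.
  apply: (gen (y p.2, - (y p.2 *m AK *m bcol p.1) 0 0)).
  rewrite mem_cat; apply/orP; left; apply/mapP; exists p => //.
  by rewrite mem_filter pps ltn_neqAle ne card_le.
have prodE : \prod_(p <- ps) ((#|p.2| == d)%:R *: 'X - (fc (#|p.2| == d)%:R p)%:P) =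
    (\prod_(p <- T) ('X - (dotw w (v p))%:P)) * kappa%:P.
  rewrite (bigID (fun p => #|p.2| == d)) /=; congr (_ * _).
    rewrite -big_filter; apply: eq_big_seq => p pT; rewrite rootE //.
    by have [_ ->] := Tface _ pT; rewrite eqxx scale1r.
  rewrite /kappa rmorph_prod; apply: eq_bigr => p /negbTE ->.
  by rewrite scale0r add0r rmorphN.
pose ev := horner_alg (opt K n * opdt K n).
have inJ q : in_tau (HAw A w beta) (ev (q * \prod_(p <- T) ('X - (dotw w (v p))%:P))).
  have FP : in_tau (HAw A w beta) (ev ((kappa^-1 *: q) *
      \prod_(p <- ps) ((#|p.2| == d)%:R *: 'X - (fc (#|p.2| == d)%:R p)%:P))).
    apply: (@face_product K d n A w beta ps (fun p => (#|p.2| == d)%:R) (fun p => y p.2)).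
      move=> a /cover[p [fp bp e]]; exists p => //; exact/psP.
    move=> p /psP[fp _] j js; have nd := independent_face sep fp.
    have [cp|np] := eqVneq; first by rewrite mul1r (yP _ nd).1.
    by rewrite mul0r ((yP _ nd).2 _).2 // ltn_neqAle np card_le.
  move: FP; rewrite prodE [_ * kappa%:P]mulrC mul_polyC -scalerAr -scalerAl scalerA.
  by rewrite mulfV // scale1r.
have root_inj : {in T &, injective (fun p => dotw w (v p))}.
  move=> p p' pT pT'; apply: contraPP => /eqP pp'.
  rewrite !rootE //; apply/eqP; rewrite -subr_eq0 /fc !face_const1E opprD addrACA.
  rewrite -entryB -mulmxBl.
  apply: (gen (y p.2 - y p'.2, cst p - cst p')); rewrite mem_cat; apply/orP; right.
  apply/mapP; exists (p, p') => //; rewrite mem_filter pp'.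
  by apply/allpairsP; exists (p, p').
have J1 : T = [::] -> in_tau (HAw A w beta) 1.
  by move=> T0; have := inJ 1; rewrite T0 big_nil mulr1 /ev rmorph1.
exists T, v; split=> //.
- by rewrite !filter_uniq ?undup_uniq.
- move=> T0; right.
  have Jroot q p : p \in T -> in_tau (HAw A w beta) (ev q) -> q.[dotw w (v p)] = 0.
    by move=> pT; apply: in_tau_HAw_root (Tface _ pT).1 (vexp _ pT).
  split.
  + case ET : T => [//|p T'] => J1'; have pT : p \in T by rewrite ET mem_head.
    have := Jroot 1 p pT; rewrite /ev rmorph1 => /(_ J1')/eqP.
    by rewrite hornerC oner_eq0.
  + by apply: monic_prod => p _; exact: monicXsubC.
  + move=> q; split=> [Jq|[r]]; last by rewrite -rmorphM => ->; exact: inJ.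
    have /dvdpP[r ->] : \prod_(p <- T) ('X - (dotw w (v p))%:P) %| q.
      rewrite -(big_map (fun p => dotw w (v p)) predT (fun c => 'X - c%:P)).
      apply: uniq_roots_dvdp.
        by apply/allP => _ /mapP[p pT ->]; apply/rootP; exact: Jroot pT Jq.
      by rewrite uniq_rootsE map_inj_in_uniq // !filter_uniq ?undup_uniq.
    by exists r; rewrite rmorphM.
- by move=> T0; left; split=> //; exact: J1.
Qed.

End IndicialPolynomial.

Theorem theorem3 (R : realType) (d n : nat) (A : 'M[int]_(d, n))
    (spanA : forall z : 'cV[int]_d, exists y : 'cV[int]_n, A *m y = z) :
  generic_weight (fun w : 'rV[int]_n =>
  generic_param (fun beta : 'cV[R[i]]_d =>
    let M : set {mpoly R[i][n]} := monomial_in A w in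
    exists (T : seq ('X_{1..n} * {set 'I_n}))
           (v : 'X_{1..n} * {set 'I_n} -> 'cV[R[i]]_n),
      [/\ uniq T,
          forall p, p \in T <-> top_standard_pair d M p,
          forall p, p \in T -> forall u, is_exponent A beta p u <-> u = v p,
          T <> [::] -> is_indicial (HAw A w beta)
                         (\prod_(p <- T) ('X - (dotw w (v p))%:P)) &
          T = [::] -> is_indicial (HAw A w beta) 0])).
Proof.
have [hs hs0 hsP] := generic_separating A; exists hs => // w /hsP sep.
exact: generic_indicial spanA sep.
Qed.
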